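(* Let $d\ge2$ be an integer, let $\rho:[0,1]^d\to\mathbb{R}_{>0}$ be a density (i.e. a measurable function), and let $X$ be a repetitive Delone set in $\mathbb{R}^d$ with a repetitivity function $R:(0,\infty)\to(0,\infty)$ satisfying $$R(r)\in O\left(r(\log r)^{\frac1d}\right),$$ i.e. there is a constant $C>0$ such that $R(r)\le C\,r(\log r)^{1/d}$ for all sufficiently large $r$. If $X$ encodes $\rho$, then $\rho$ is constant almost everywhere.
   Context: $\mathbb{R}^d$ carries the Euclidean metric; $B(x,r)$ is the open Euclidean ball of radius $r>0$ centred at $x$; $\mathcal{L}$ is Lebesgue measure. Delone set: a discrete set $X\subset\mathbb{R}^d$ such that (uniform discreteness) there is $r>0$ such that every ball of radius $r$ in $\mathbb{R}^d$ contains at most one point of $X$, and (relative density) there is $R>0$ such that every ball of radius $R$ in $\mathbb{R}^d$ contains at least one point of $X$. Repetitivity: for $x\in X$ and $r>0$ the $r$-patch centred at $x$ is $\mathcal{P}_{x,r}:=X\cap B(x,r)$. An $X$-translate of $\mathcal{P}_{x,r}$ is an $r$-patch $\mathcal{P}_{y,r}$ with $y\in X$ and $\mathcal{P}_{y,r}=y-x+\mathcal{P}_{x,r}$. Given a non-decreasing function $R:(0,\infty)\to(0,\infty)$, $X$ is $R(r)$-repetitive, and $R$ is called a repetitivity function of $X$, if for each $r>0$, each $x\in X$ and each $y\in\mathbb{R}^d$, an $X$-translate of $\mathcal{P}_{x,r}$ intersects $B(y,R(r))$. $X$ is repetitive if it has a repetitivity function. Encoding: a Delone set $X\subset\mathbb{R}^d$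 encodes a measurable function $\rho:[0,1]^d\to\mathbb{R}_{>0}$ if there exist a sequence $r_n\to\infty$ of positive reals, a sequence of closed cubes $Q_n\subset\mathbb{R}^d$ with sidelength $r_n$, and a sequence of bijective affine maps $\varphi_n:[0,1]^d\to Q_n$ such that the measures $\mu_n(A):=\frac{|X\cap\varphi_n(A)|}{r_n^d}$, $A\subseteq[0,1]^d$, satisfy $\mu_n\rightharpoonup\rho\mathcal{L}$ on $[0,1]^d$, where $\rho\mathcal{L}(A)=\int_A\rho\,d\mathcal{L}$ and $\rightharpoonup$ is weak convergence (convergence of integrals of all bounded continuous functions $[0,1]^d\to\mathbb{R}$). *)

(* Defs.v *)
From HB Require Import structures.
From mathcomp Require Import all_boot all_order all_algebra.
From mathcomp Require Import all_classical all_reals all_analysis.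

Set Implicit Arguments.
Unset Strict Implicit.
Unset Printing Implicit Defensive.

Import Order.TTheory GRing.Theory Num.Theory.
Import numFieldNormedType.Exports.

Local Open Scope classical_set_scope.
Local Open Scope ring_scope.

(** ** Euclidean geometry of R^d, represented by row vectors

    The library norm on ['rV[R]_d] is the sup norm (it induces the same
    topology), hence an explicit Euclidean norm. *)

Definition enorm (R : realType) (d : nat) (x : 'rV[R]_d) : R :=
  Num.sqrt (\sum_(i < d) x ord0 i ^+ 2).

Definition eball (R : realType) (d : nat) (x : 'rV[R]_d) (r : R)
    : set 'rV[R]_d :=
  [set y | enorm (y - x) < r].

Definition unit_cube (R : realType) (d : nat) : set 'rV[R]_d :=
  [set x | forall i : 'I_d, 0 <= x ord0 i <= 1].
Arguments unit_cube {R d}.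

(** Cubes are not required to be parallel to the coordinate axes: [U] is an
    arbitrary orthogonal matrix. *)
Definition closed_cube (R : realType) (d : nat) (s : R) (Q : set 'rV[R]_d)
    : Prop :=
  exists (v : 'rV[R]_d) (U : 'M[R]_d),
    U *m U^T = 1%:M /\ Q = [set v + s *: (x *m U) | x in unit_cube].

Definition affine_map (R : realType) (d : nat) (phi : 'rV[R]_d -> 'rV[R]_d)
    : Prop :=
  exists (M : 'M[R]_d) (b : 'rV[R]_d), forall x, phi x = x *m M + b.

(** ** Lebesgue measure on R^d

    The outer measure is the infimum of the total volume over the countable
    (possibly finite or empty) covers by closed boxes; the measure is its
    restriction to the Caratheodory-measurable sets, i.e. the Lebesgue
    measurable sets. A box is given by two opposite corners, and is empty, of
    volume 0, when these are in the wrong order. *)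

Definition box (R : realType) (d : nat) (ab : 'rV[R]_d * 'rV[R]_d)
    : set 'rV[R]_d :=
  [set x | forall i : 'I_d, ab.1 ord0 i <= x ord0 i <= ab.2 ord0 i].

Definition box_volume (R : realType) (d : nat) (ab : 'rV[R]_d * 'rV[R]_d)
    : R :=
  \prod_(i < d) Num.max 0 (ab.2 ord0 i - ab.1 ord0 i).

Definition box_cover (R : realType) (d : nat) (A : set 'rV[R]_d)
    : set (set nat * (nat -> 'rV[R]_d * 'rV[R]_d)) :=
  [set c | A `<=` \bigcup_(k in c.1) box (c.2 k)].

Definition lebesgue_outer (R : realType) (d : nat) (A : set 'rV[R]_d)
    : \bar R :=
  ereal_inf [set \esum_(k in c.1) (box_volume (c.2 k))%:E | c in box_cover A].

Section lebesgue_outer_measure.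
Context (R : realType) (d : nat).
Local Open Scope ereal_scope.
Local Notation mu := (@lebesgue_outer R d).

Let vol_ge0 (ab : 'rV[R]_d * 'rV[R]_d) : 0 <= (box_volume ab)%:E.
Proof. by rewrite lee_fin prodr_ge0// => i _; rewrite le_max lexx. Qed.

Let mu_ge0 A : 0 <= mu A.
Proof.
by apply: le_ereal_inf_tmp => _ [c _ <-]; apply: esum_ge0 => k _; exact: vol_ge0.
Qed.

Let mu0 : mu set0 = 0.
Proof.
apply/eqP; rewrite eq_le mu_ge0 andbT.
apply: ereal_inf_lbound; exists (set0, fun=> (0, 0)%R); first by [].
by rewrite esum_set0.
Qed.

Let le_mu : {homo mu : A B / A `<=` B >-> A <= B}.
Proof.
move=> A B AB; apply: ereal_inf_le_tmp => _ [c Bc <-].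
by exists c => //; exact: subset_trans Bc.
Qed.

Let mu_sigma_subadditive : sigma_subadditive mu.
Proof.
move=> A; have [[i ioo]|] := pselect (exists i, mu (A i) = +oo).
  rewrite (eseries_pinfty _ _ ioo) ?leey// => n _.
  by rewrite -ltNye (lt_le_trans _ (mu_ge0 _)).
rewrite -forallNE => Aoo; apply/lee_addgt0Pr => e e0.
rewrite (le_trans _ (epsilon_trick _ _ (ltW e0)))//.
pose w (c : set nat * (nat -> 'rV[R]_d * 'rV[R]_d)) :=
  \esum_(k in c.1) (box_volume (c.2 k))%:E.
have [G PG] : {G : nat -> set nat * (nat -> 'rV[R]_d * 'rV[R]_d) &
    forall n, box_cover (A n) (G n) /\
              w (G n) <= mu (A n) + (e / (2 ^ n.+1)%:R)%:E}.
  apply: (@choice _ _ (fun n c => box_cover (A n) c /\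
    w c <= mu (A n) + (e / (2 ^ n.+1)%:R)%:E)) => n.
  have en1 : (0 < e / (2 ^ n.+1)%:R)%R by rewrite divr_gt0.
  have fin : mu (A n) \is a fin_num.
    by rewrite ge0_fin_numE// ltey; apply/eqP; exact: Aoo.
  have [_ [c Ac <-] /ltW le_c] := lb_ereal_inf_adherent en1 fin.
  by exists c.
pose J n := (G n).1.
pose B k := if unpickle k is Some p then (G p.1).2 p.2 else (0, 0)%R.
apply: (@le_trans _ _ (w (pickle @` ([set: nat] `*`` J), B))).
  apply: ereal_inf_lbound; exists (pickle @` ([set: nat] `*`` J), B) => //.
  move=> x [n _ /((PG n).1 x) [k Gk xk]].
  by exists (pickle (n, k)) => /=; [exists (n, k) | rewrite /B pickleK].
rewrite /w /= esum_image; last by move=> p q _ _ /(pcan_inj pickleK).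
under eq_esum do rewrite /B pickleK.
rewrite -(esum_esum (a := fun n k => (box_volume ((G n).2 k))%:E))//.
rewrite -nneseries_esumT; last first.
  by move=> n; apply: esum_ge0 => k _; exact: vol_ge0.
apply: lee_nneseries => n _; last exact: (PG n).2.
by move=> _; apply: esum_ge0 => k _; exact: vol_ge0.
Qed.

HB.instance Definition _ := isOuterMeasure.Build R 'rV[R]_d mu
  mu0 mu_ge0 le_mu mu_sigma_subadditive.

End lebesgue_outer_measure.

Definition lebesgue_outer_measure (R : realType) (d : nat)
    : {outer_measure set 'rV[R]_d -> \bar R} :=
  @lebesgue_outer R d.

(** R^d equipped with the sigma-algebra of Lebesgue measurable sets; as a type
    it is ['rV[R]_d]. *)
Notation lebesgueType R d := (caratheodory_type (lebesgue_outer_measure R d)).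

Definition lebesgue_rV (R : realType) (d : nat)
    : {measure set (lebesgueType R d) -> \bar R} :=
  (lebesgue_outer_measure R d : set (lebesgueType R d) -> \bar R).
Arguments lebesgue_rV {R d}.

(** ** Delone sets and repetitivity *)

Definition discrete_set (R : realType) (d : nat) (X : set 'rV[R]_d) : Prop :=
  forall x, X x -> exists2 e : R, 0 < e & X `&` eball x e = [set x].

Definition uniformly_discrete (R : realType) (d : nat) (X : set 'rV[R]_d)
    : Prop :=
  exists2 r : R, 0 < r & forall c : 'rV[R]_d,
    forall x y, (X `&` eball c r) x -> (X `&` eball c r) y -> x = y.

Definition relatively_dense (R : realType) (d : nat) (X : set 'rV[R]_d)
    : Prop :=
  exists2 r : R, 0 < r & forall c : 'rV[R]_d, X `&` eball c r !=set0.

Definition delone (R : realType) (d : nat) (X : set 'rV[R]_d) : Prop :=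
  [/\ discrete_set X, uniformly_discrete X & relatively_dense X].

Definition patch (R : realType) (d : nat) (X : set 'rV[R]_d) (x : 'rV[R]_d)
    (r : R) : set 'rV[R]_d :=
  X `&` eball x r.

(** [is_translate X x y r]: the r-patch centred at [y] is an X-translate of the
    one centred at [x]. *)
Definition is_translate (R : realType) (d : nat) (X : set 'rV[R]_d)
    (x y : 'rV[R]_d) (r : R) : Prop :=
  X y /\ patch X y r = [set y - x + z | z in patch X x r].

(** A function (0,oo) -> (0,oo) is a total function of which only the values
    at positive arguments matter. *)
Definition repetitivity_function (R : realType) (d : nat) (X : set 'rV[R]_d)
    (Rep : R -> R) : Prop :=
  [/\ forall r, 0 < r -> 0 < Rep r,
      forall r s, 0 < r -> r <= s -> Rep r <= Rep s &
      forall (r : R) (x y : 'rV[R]_d), 0 < r -> X x ->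
        exists x', is_translate X x x' r /\
                   patch X x' r `&` eball y (Rep r) !=set0].

(** ** Encoding of densities

    Measures on [0,1]^d are represented by set functions on R^d that only
    take into account the part of their argument inside the unit cube; only
    the values of densities and test functions on the unit cube matter. *)

Definition encoding_measure (R : realType) (d : nat) (X : set 'rV[R]_d)
    (r : R) (phi : 'rV[R]_d -> 'rV[R]_d)
    : set (lebesgueType R d) -> \bar R :=
  fun A => (counting (X `&` phi @` (A `&` unit_cube)) * (r ^- d)%:E)%E.

Definition density_measure (R : realType) (d : nat) (rho : 'rV[R]_d -> R)
    : set (lebesgueType R d) -> \bar R :=
  fun A => (\int[lebesgue_rV]_(x in A `&` unit_cube) (rho x)%:E)%E.

Definition weak_cvg (R : realType) (d : nat)
    (mu : nat -> set (lebesgueType R d) -> \bar R)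
    (nu : set (lebesgueType R d) -> \bar R) : Prop :=
  forall f : 'rV[R]_d -> R,
    {within unit_cube, continuous f} -> [bounded f x | x in unit_cube] ->
    (\int[mu n]_(x in unit_cube) (f x)%:E)%E @[n --> \oo] -->
    (\int[nu]_(x in unit_cube) (f x)%:E)%E.

Definition encodes (R : realType) (d : nat) (X : set 'rV[R]_d)
    (rho : 'rV[R]_d -> R) : Prop :=
  exists (r : nat -> R) (Q : nat -> set 'rV[R]_d)
         (phi : nat -> 'rV[R]_d -> 'rV[R]_d),
    [/\ forall n, 0 < r n,
        r n @[n --> \oo] --> +oo,
        forall n, closed_cube (r n) (Q n),
        forall n, affine_map (phi n) /\ set_bij unit_cube (Q n) (phi n) &
        weak_cvg (fun n => encoding_measure X (r n) (phi n))
                 (density_measure rho)].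

(* Main.v *)
(** Every cube [Q_n] is pulled back to an axis-parallel cube by a linear map
    [T_n]; both [T_n] and its inverse have bounded entries, so the sets
    [Y_n = {x | x T_n in X}] satisfy the hypotheses on [X] with uniform constants.

    Let [u(t)] be the largest density of such a [Y] in cubes of side [t]; it does
    not increase when [t] is doubled. If some cube of side [2^J] has density [al]
    and [u(2^J) > al + eps], then at each smaller scale [s] there is a cube of
    density at most [al], and by repetitivity every cube of side
    [m s] contains a translated copy of it, where [m = O((log s)^(1/d))]. Counting
    the rest of the large cube with much smaller grid cubes gives
    [u(m s) <= u(s / k) - c / m^d]. Since [m^d = O(log s)], these decrements add up
    like a harmonic series, which bounds [J]. Hence at some fixed scale the
    densities of all cubes agree up to [eps], uniformly in [n].

    Letting [n] tend to infinity, [rho L (B) <= D vol(B)] for all boxes [B], where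
    [D] is the total mass of [rho L]. Covers by boxes turn this into [rho L <= D L],
    and the total masses on the unit cube force equality. *)

From HB Require Import structures.
Require Import Defs.
From mathcomp Require Import all_boot all_order all_algebra.
From mathcomp Require Import all_classical all_reals all_analysis.
From mathcomp Require Import measurable_realfun finmap zify ring lra.

Import Order.TTheory GRing.Theory Num.Theory.
Import numFieldNormedType.Exports.

Local Open Scope classical_set_scope.
Local Open Scope ring_scope.

Set Implicit Arguments.
Unset Strict Implicit.
Unset Printing Implicit Defensive.

(** * Slowly decreasing sequences *)

Lemma sum_shift (R : realType) (u : nat -> R) (m n l : nat) :
  \sum_(j < n) (u (m + j)%N - u (m + j + l)%N) =
  \sum_(i < l) (u (m + i)%N - u (m + n + i)%N).
Proof.
elim: n => [|n IH].
  by rewrite big_ord0 big1// => i _; rewrite addn0 subrr.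
rewrite big_ord_recr/= IH.
have tele p : \sum_(i < l) (u (p + i)%N - u (p.+1 + i)%N) = u p - u (p + l)%N.
  elim: (l) => [|k IHk]; first by rewrite big_ord0 addn0 subrr.
  by rewrite big_ord_recr/= IHk addSn addnS; ring.
rewrite -tele -big_split/=; apply: eq_bigr => i _.
by rewrite addnS; ring.
Qed.

(** Summed over the block, the differences [u j - u (j + l)] reduce by [sum_shift] to [l]
    differences, each at most the total drop of [u]. *)
Lemma nonincreasing_decrement (R : realType) (u : nat -> R) (m n l : nat)
    (c : R) :
  {homo u : i j / (i <= j)%N >-> j <= i} ->
  (forall j, (m <= j < m + n)%N -> u (j + l)%N <= u j - c) ->
  n%:R * c <= l%:R * (u m - u (m + n + l)%N).
Proof.
move=> u_dec u_drop.
apply: (@le_trans _ _ (\sum_(j < n) (u (m + j)%N - u (m + j + l)%N))).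
  rewrite mulr_natl -[n in leLHS]card_ord -sumr_const; apply: ler_sum => j _.
  have /u_drop : (m <= m + j < m + n)%N by rewrite leq_addr ltn_add2l/=.
  lra.
rewrite sum_shift mulr_natl -[l in leRHS]card_ord -sumr_const.
apply: ler_sum => i _.
have := u_dec m (m + i)%N (leq_addr _ _).
have : (m + n + i <= m + n + l)%N by rewrite leq_add2l ltnW.
by move=> /u_dec; rewrite card_ord; lra.
Qed.

Lemma harmonic_sum_unbounded (R : realType) (q0 A : nat) (C : R) :
  exists n, C < \sum_(i < n) (q0 + i + A).+1%:R^-1.
Proof.
apply: contrapT => /forallNP H; apply: (@dvg_harmonic R).
apply: nondecreasing_is_cvgn.
  by apply: nondecreasing_series => n _ _; exact: harmonic_ge0.
exists (C + \sum_(i < q0 + A) i.+1%:R^-1) => _ [n _ <-].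
apply: (@le_trans _ _ (series (@harmonic R) ((q0 + A) + n)%N)).
  have := @nondecreasing_series R harmonic xpredT 0 (fun n _ _ => harmonic_ge0 n).
  by apply; rewrite leq_addl.
rewrite /series/= big_mkord big_split_ord/= addrC lerD//.
have /negP := H n; rewrite -leNgt; apply: le_trans.
apply: ler_sum => i _; rewrite lef_pV2 ?posrE// ler_nat ltnS.
by rewrite -!addnA leq_add2l addnC.
Qed.

(* Telescoping over a block [2 ^ (d q) <= j < 2 ^ (d q + 1)] shows that [u] loses
   [c / (q + A)] from [2 ^ (d q)] to [2 ^ (d (q + 1))]; the harmonic series diverges. *)
Lemma slow_decrement_bounded (R : realType) (C c : R) (A q0 d : nat) :
  0 < c -> (2 <= d)%N ->
  exists J, forall u : nat -> R,
    (forall j, (j <= J)%N -> 0 <= u j <= C) ->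
    {homo u : i j / (i <= j)%N >-> j <= i} ->
    (forall q j, (q0 <= q)%N -> (2 ^ (d * q) <= j < 2 ^ (d * q).+1)%N ->
      (j + (q + A) <= J)%N -> u (j + (q + A))%N <= u j - c / 2 ^+ (d * q)) ->
    False.
Proof.
(* Starting at [q1] gives [A <= q], so that a block followed by the shift [q + A] ends by
   [2 ^ (d (q + 1))]. The [n] blocks below [J] then lose more than [C] in total. *)
move=> c0 d2; pose q1 := maxn q0 A.
have [n Hn] := harmonic_sum_unbounded q1 A (C / c).
exists (2 ^ (d * (q1 + n)))%N => u ubnd udec udrop.
have step i : (i < n)%N ->
    c / (q1 + i + A).+1%:R <= u (2 ^ (d * (q1 + i)))%N - u (2 ^ (d * (q1 + i).+1))%N.
  move=> ilt; set q := (q1 + i)%N.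
  have qA : (A <= q)%N by rewrite /q /q1; lia.
  have h1 : (2 ^ (d * q).+1 + (q + A) <= 2 ^ (d * q.+1))%N.
    have : (q < 2 ^ q)%N by rewrite ltn_expl.
    have : (2 ^ q <= 2 ^ (d * q))%N by rewrite leq_exp2l// leq_pmull//; lia.
    have -> : (d * q.+1 = (d - 2) + (d * q).+2)%N by lia.
    have := @leq_pexp2l 2 (d * q).+2 (d - 2 + (d * q).+2) isT (leq_addl _ _).
    rewrite !expnS; lia.
  have h2 : (2 ^ (d * q.+1) <= 2 ^ (d * (q1 + n)))%N.
    by rewrite leq_exp2l// leq_mul2l; apply/orP; right; rewrite /q; lia.
  have /(nonincreasing_decrement udec) : forall j,
      (2 ^ (d * q) <= j < 2 ^ (d * q) + 2 ^ (d * q))%N ->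
      u (j + (q + A))%N <= u j - c / 2 ^+ (d * q).
    move=> j /andP[j1 j2].
    have j3 : (j < 2 ^ (d * q).+1)%N by rewrite expnS mul2n -addnn.
    apply: udrop; rewrite ?j1//; first by rewrite /q /q1; lia.
    by apply: leq_trans h2; apply: leq_trans h1; rewrite leq_add2r ltnW.
  (* The [2 ^ (d q)] indices of the block, each with decrement [c / 2 ^ (d q)], add up to [c]. *)
  rewrite natrX mulrCA divff ?expf_neq0// mulr1.
  rewrite addnn -mul2n -expnS => h3.
  rewrite ler_pdivrMr// mulrC; apply: (le_trans h3).
  have /udec h4 := h1.
  have h5 : u (2 ^ (d * q).+1 + (q + A))%N <= u (2 ^ (d * q))%N.
    by apply: udec; rewrite expnS; lia.
  apply: ler_pM => //; [lra| by rewrite ler_nat |lra].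
have sumle : \sum_(i < n) (c / (q1 + i + A).+1%:R) <=
    u (2 ^ (d * q1))%N - u (2 ^ (d * (q1 + n)))%N.
  elim: (n) step => [|k IH] step; first by rewrite big_ord0 addn0 subrr.
  rewrite big_ord_recr/=.
  rewrite addnS (le_trans (lerD (IH (fun i h => step i (ltnW h))) (step k (ltnSn k))))//.
  by rewrite addrA subrK.
have : (2 ^ (d * q1) <= 2 ^ (d * (q1 + n)))%N by rewrite leq_exp2l// leq_mul2l leq_addr orbT.
move=> /ubnd; have := ubnd _ (leqnn _).
move: Hn sumle; rewrite -big_distrr/= ltr_pdivrMr// mulrC; lra.
Qed.

(** * Counting points in cubes *)

(** Meaningful for finite sets only, hence the finiteness side conditions below. *)
Definition npts (T : choiceType) (Y : set T) : nat := #|` fset_set Y|.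

Lemma npts_le (T : choiceType) (Y Z : set T) :
  finite_set Z -> Y `<=` Z -> (npts Y <= npts Z)%N.
Proof.
move=> Zfin YZ; apply: fsubset_leq_card.
by rewrite -fset_set_sub//; exact: sub_finite_set Zfin.
Qed.

Lemma npts_image (T U : choiceType) (f : T -> U) (Y : set T) :
  injective f -> finite_set Y -> npts (f @` Y) = npts Y.
Proof.
move=> f_inj Yfin.
by rewrite /npts fset_set_image// card_imfset.
Qed.

Lemma npts_le_sum (T : choiceType) (I : finType) (P : pred I) (Y : set T)
    (Z : I -> set T) :
  (forall i, finite_set (Z i)) ->
  (forall x, Y x -> exists2 i, P i & Z i x) ->
  (npts Y <= \sum_(i | P i) npts (Z i))%N.
Proof.
move=> Zfin YZ.
have [Ufin Ule] : finite_set (\big[setU/set0]_(i | P i) Z i) /\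
    (npts (\big[setU/set0]_(i | P i) Z i) <= \sum_(i | P i) npts (Z i))%N.
  elim/big_rec2 : _ => [|i n A Pi [Afin An]].
    by split => //; rewrite /npts fset_set0 cardfs0.
  split; first by rewrite finite_setU.
  rewrite /npts fset_setU// cardfsU.
  by apply: (leq_trans (leq_subr _ _)); rewrite leq_add2l.
apply: leq_trans Ule; apply: npts_le => // x /YZ[i Pi Zix].
by rewrite (bigD1 i)//=; left.
Qed.

(** Double counting: after exchanging the sums, disjointness leaves every point of [Y] at most one
    index. *)
Lemma sum_npts_le (T : choiceType) (I : finType) (Y : set T) (Z : I -> set T) :
  finite_set Y -> (forall i, Z i `<=` Y) ->
  (forall i j x, Z i x -> Z j x -> i = j) ->
  (\sum_i npts (Z i) <= npts Y)%N.
Proof.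
move=> Yfin ZY Zdisj.
have E i : npts (Z i) = (\sum_(x <- fset_set Y) `[< Z i x >])%N.
  have Zfin : finite_set (Z i) := sub_finite_set (ZY i) Yfin.
  transitivity (size [seq x <- fset_set Y | `[< Z i x >]]).
    apply/perm_size/uniq_perm; rewrite ?filter_uniq ?fset_uniq// => x.
    rewrite mem_filter !in_fset_set//; apply/idP/andP.
      by move=> /set_mem Zx; split; [exact/asboolP|apply/mem_set/(ZY i)].
    by move=> [/asboolP Zx _]; exact: mem_set.
  rewrite size_filter -sum1_count big_mkcond/=.
  by apply: eq_bigr => x _; case: asboolP.
under eq_bigr do rewrite E.
rewrite exchange_big/=.
apply: (@leq_trans (\sum_(x <- fset_set Y) 1)%N); last first.
  by rewrite sum1_size.
apply: leq_sum => x _.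
have [[i Zi]|no] := pselect (exists i, Z i x); last first.
  rewrite big1// => i _; case: asboolP => // Zi; by case: no; exists i.
rewrite (bigD1 i)//= big1 ?addn0 ?leq_b1// => j ji.
by case: asboolP => // Zj; move: ji; rewrite (Zdisj _ _ _ Zi Zj) eqxx.
Qed.

Lemma truncn_div_bounds (R : realType) (y t : R) : 0 < t -> 0 <= y ->
  (Num.truncn (y / t))%:R * t <= y < (Num.truncn (y / t))%:R * t + t.
Proof.
move=> t0 y0; have /truncn_itv : 0 <= y / t by rewrite divr_ge0// ltW.
set q := Num.truncn _; rewrite ler_pdivlMr// ltr_pdivrMr// -natr1.
by rewrite [(_ + 1) * _]mulrDl mul1r.
Qed.

Section tiling.
Variables (R : realType) (d : nat).
Implicit Types (a b p x : 'rV[R]_d) (s t : R) (Y : set 'rV[R]_d).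

(** Half-open, so that the cells of a grid partition a box and no point is counted twice. *)
Definition hcube a s : set 'rV[R]_d :=
  [set x | forall i, a ord0 i <= x ord0 i < a ord0 i + s].

Definition hbox a (m : 'I_d -> nat) t : set 'rV[R]_d :=
  [set x | forall i, a ord0 i <= x ord0 i < a ord0 i + (m i)%:R * t].

Local Notation tile m := {dffun forall i : 'I_d, 'I_(m i)}.

Definition tile_corner a (m : 'I_d -> nat) t (k : tile m) : 'rV[R]_d :=
  \row_i (a ord0 i + (k i)%:R * t).

Lemma card_tile (m : 'I_d -> nat) : #|{: tile m}| = (\prod_i m i)%N.
Proof.
rewrite card_dep_ffun foldrE big_map big_enum/=.
by apply: eq_bigr => i _; rewrite card_ord.
Qed.

Lemma card_tile_cst (n : nat) : #|{: tile (fun=> n)}| = (n ^ d)%N.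
Proof. by rewrite card_tile prod_nat_const card_ord. Qed.

Lemma hbox_cst a n t : hbox a (fun=> n) t = hcube a (n%:R * t).
Proof. by []. Qed.

Lemma hbox_tile a m t x : 0 < t -> hbox a m t x ->
  exists k : tile m, hcube (tile_corner a t k) t x.
Proof.
move=> t0 Hx.
have kP i : (Num.truncn ((x ord0 i - a ord0 i) / t) < m i)%N.
  have /andP[h1 h2] := Hx i.
  rewrite truncn_lt_nat ?divr_ge0 ?subr_ge0// ?ltW//.
  by rewrite ltr_pdivrMr// ltrBlDl.
exists [ffun i => Ordinal (kP i)] => i; rewrite mxE ffunE/=.
have /andP[h1 h2] := Hx i.
have xa0 : 0 <= x ord0 i - a ord0 i by rewrite subr_ge0.
have /andP[H1 H2] := truncn_div_bounds t0 xa0.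
by apply/andP; split; lra.
Qed.

Lemma tile_sub_hbox a m t (k : tile m) : 0 < t ->
  hcube (tile_corner a t k) t `<=` hbox a m t.
Proof.
move=> t0 x Hx i; have /andP[] := Hx i; rewrite mxE => h1 h2.
have kt0 : 0 <= (k i)%:R * t by rewrite mulr_ge0// ltW.
have : (k i).+1%:R * t <= (m i)%:R * t by rewrite ler_wpM2r ?ler_nat// ltW.
by rewrite -natr1 mulrDl mul1r => h3; apply/andP; split; lra.
Qed.

Lemma tile_inj a m t (k l : tile m) x : 0 < t ->
  hcube (tile_corner a t k) t x -> hcube (tile_corner a t l) t x -> k = l.
Proof.
move=> t0 Hk Hl; apply/ffunP => i; apply/val_inj/eqP => /=.
have /andP[] := Hk i; have /andP[] := Hl i; rewrite !mxE => l1 l2 k1 k2.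
have H (p q : nat) : a ord0 i + p%:R * t <= x ord0 i ->
    x ord0 i < a ord0 i + q%:R * t + t -> (p <= q)%N.
  move=> h1 h2; rewrite -ltnS -(@ltr_nat R) -(ltr_pM2r t0) -natr1 mulrDl mul1r.
  lra.
by rewrite eqn_leq (H _ _ k1 l2) (H _ _ l1 k2).
Qed.

Definition locally_finite Y := forall a s, finite_set (Y `&` hcube a s).

Definition ncube Y a s : R := (npts (Y `&` hcube a s))%:R.

Lemma ncube_ge0 Y a s : 0 <= ncube Y a s.
Proof. exact: ler0n. Qed.

Lemma npts_hbox_le Y a m t (U : R) : locally_finite Y -> 0 < t ->
  (forall b, ncube Y b t <= U) ->
  (npts (Y `&` hbox a m t))%:R <= (\prod_i (m i)%:R) * U.
Proof.
move=> Yfin t0 YU.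
have : (npts (Y `&` hbox a m t) <=
    \sum_(k : tile m) npts (Y `&` hcube (tile_corner a t k) t))%N.
  apply: npts_le_sum => [k|x [Yx /(hbox_tile t0)[k kx]]]; first exact: Yfin.
  by exists k.
rewrite -(ler_nat R) => /le_trans; apply; rewrite natr_sum.
apply: le_trans (ler_sum _ (fun k _ => YU (tile_corner a t k))) _.
by rewrite sumr_const card_tile -natr_prod mulr_natl.
Qed.

Lemma ncube_mul_le Y a n t (U : R) : locally_finite Y -> 0 < t ->
  (forall b, ncube Y b t <= U) -> ncube Y a (n%:R * t) <= n%:R ^+ d * U.
Proof.
move=> Yfin t0 /(npts_hbox_le a (fun=> n) Yfin t0).
by rewrite hbox_cst prodr_const card_ord.
Qed.

(** Pigeonhole: the [n ^ d] cells are disjoint, so the sparsest one has at most the average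
    count. *)
Lemma exists_sparse_tile Y a n t : locally_finite Y -> 0 < t -> (0 < n)%N ->
  exists b, n%:R ^+ d * ncube Y b t <= ncube Y a (n%:R * t).
Proof.
move=> Yfin t0 n0; apply: contrapT => /forallNP H.
pose m := fun _ : 'I_d => n.
have : (\sum_(k : tile m) npts (Y `&` hcube (tile_corner a t k) t) <=
    npts (Y `&` hbox a m t))%N.
  apply: sum_npts_le => [|k x [Yx /(tile_sub_hbox t0)//]|k l x [_ kx] [_ lx]].
    exact: (Yfin a (n%:R * t)).
  exact: tile_inj kx lx.
rewrite leqNgt => /negP; apply.
rewrite -(ltr_nat R) natr_sum.
have n0R : (0 : R) < n%:R ^+ d by rewrite exprn_gt0// ltr0n.
apply: (@le_lt_trans _ _ (\sum_(k : tile m) ncube Y a (n%:R * t) / n%:R ^+ d)).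
  rewrite sumr_const card_tile_cst -[_ *+ (n ^ d)]mulr_natr natrX.
  by rewrite mulfVK// gt_eqF.
apply: ltr_sum; last first.
  move=> k _; rewrite ltr_pdivrMr// [ltRHS]mulrC ltNge.
  exact/negP/(H (tile_corner a t k)).
(* Strict comparison of sums needs a nonempty index set; [0 < n] provides the cell with index 0. *)
apply/hasP; exists [ffun=> Ordinal n0] => //; exact: mem_index_enum.
Qed.

(* Wherever it lies, the subcube contains at least [(k - 1) ^ d] cubes of the grid
   of mesh [t] of the large cube; these are traded for the subcube itself. *)
Lemma ncube_with_subcube_le Y a p (n k : nat) t (U : R) :
  locally_finite Y -> 0 < t -> 0 <= U -> (0 < k)%N ->
  (forall b, ncube Y b t <= U) ->
  (forall i, a ord0 i <= p ord0 i /\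
     p ord0 i + k%:R * t <= a ord0 i + n%:R * t) ->
  ncube Y a (n%:R * t) <=
    ncube Y p (k%:R * t) + (n%:R ^+ d - (k.-1)%:R ^+ d) * U.
Proof.
move=> Yfin t0 U0 k0 YU ap.
pose m := fun _ : 'I_d => n.
have apt i : 0 <= p ord0 i - a ord0 i by rewrite subr_ge0; have [] := ap i.
(* The first grid coordinate strictly beyond [p], at distance at most [t] from it; this rounding
   costs one cell per axis, whence [k - 1]. *)
pose c i := (Num.truncn ((p ord0 i - a ord0 i) / t)).+1.
have c1 i : p ord0 i <= a ord0 i + (c i)%:R * t.
  have /andP[_] := truncn_div_bounds t0 (apt i).
  by rewrite /c -natr1 [(_ + 1) * _]mulrDl mul1r; lra.
have c2 i : a ord0 i + (c i)%:R * t <= p ord0 i + t.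
  have /andP[+ _] := truncn_div_bounds t0 (apt i).
  by rewrite /c -natr1 [(_ + 1) * _]mulrDl mul1r; lra.
have cn i (j : 'I_k.-1) : (c i + j < n)%N.
  rewrite -(ltr_nat R) -(ltr_pM2r t0) natrD mulrDl.
  have [_ h] := ap i; have := c2 i.
  have : j.+1%:R * t <= (k%:R - 1) * t.
    apply: ler_wpM2r; first exact: ltW.
    by rewrite lerBrDr natr1 ler_nat; have := ltn_ord j; lia.
  rewrite -natr1 !mulrDl mul1r; lra.
pose iota (j : tile (fun=> k.-1)) : tile m := [ffun i => Ordinal (cn i (j i))].
have iota_inj : injective iota.
  move=> j l /ffunP jl; apply/ffunP => i; have := jl i; rewrite !ffunE.
  by move=> /(congr1 val)/= /addnI/val_inj.
pose S := [set iota j | j in {: tile (fun=> k.-1)}]%SET.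
have cS : #|S| = (k.-1 ^ d)%N by rewrite card_imset// card_tile_cst.
have Scube l : l \in S -> hcube (tile_corner a t l) t `<=` hcube p (k%:R * t).
  move=> /imsetP[j _ ->] x Hx i; have := Hx i; rewrite mxE ffunE/= => /andP[].
  rewrite natrD mulrDl => h1 h2.
  have j0 : 0 <= (j i)%:R * t by rewrite mulr_ge0// ltW.
  have : (j i).+1%:R * t <= (k%:R - 1) * t.
    apply: ler_wpM2r; first exact: ltW.
    by rewrite lerBrDr natr1 ler_nat; have := ltn_ord (j i); lia.
  rewrite -natr1 !mulrDl mul1r => h3.
  have := c1 i; have := c2 i => h4 h5.
  by apply/andP; split; lra.
(* [None] stands for the subcube, [Some l] for a cell of the grid; the cells in [S] are covered by
   the subcube. *)
pose Z (o : option (tile m)) := if o is Some l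
  then Y `&` hcube (tile_corner a t l) t else Y `&` hcube p (k%:R * t).
pose P (o : option (tile m)) := if o is Some l then l \notin S else true.
have : (npts (Y `&` hcube a (n%:R * t)) <= \sum_(o | P o) npts (Z o))%N.
  apply: npts_le_sum => [[l|]|]; [exact: Yfin|exact: Yfin|].
  move=> x [Yx]; rewrite -hbox_cst => /(hbox_tile t0)[l lx].
  have [lS|lS] := boolP (l \in S); last by exists (Some l).
  by exists None => //=; split => //; exact: Scube lx.
rewrite -(ler_nat R) natr_sum => /le_trans; apply.
rewrite (bigD1 None)//= lerD2l.
rewrite (reindex_omap Some id)/=; last by case.
apply: (@le_trans _ _ (\sum_(l in ~: S) U)).
  rewrite (eq_bigl (fun l => l \in ~: S)); last by move=> l; rewrite inE eqxx !andbT.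
  by apply: ler_sum => l _; exact: YU.
rewrite sumr_const cardsCs finset.setCK cS card_tile_cst.
rewrite -[U *+ _]mulr_natl natrB ?natrX//.
by rewrite -cS -card_tile_cst max_card.
Qed.
End tiling.

(** * A scale at which all cubes have nearly the same density *)

Lemma bernoulli_le (R : realType) (x : R) (n : nat) : 0 <= x <= 1 ->
  1 - n%:R * x <= (1 - x) ^+ n.
Proof.
move=> /andP[x0 x1]; elim: n => [|n IH]; first by rewrite mul0r subr0 expr0.
rewrite exprS; apply: (@le_trans _ _ ((1 - x) * (1 - n%:R * x))); last first.
  by rewrite ler_wpM2l// subr_ge0.
rewrite -natr1.
have : 0 <= n%:R * (x * x) by rewrite mulr_ge0// mulr_ge0.
by nra.
Qed.

(** [J] is fixed before [Y], which makes the scale uniform. Since [j] is the binary logarithm of the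
    side [2 ^ j], the condition on [q] says that [2 ^ q] is about the [d]-th root of this logarithm;
    [2 ^ (q + A)] is the ratio of the large cube to the copied one. *)
Lemma density_gap (R : realType) (d : nat) (C eps : R) (A : nat)
    (q0 : nat -> nat) :
  (2 <= d)%N -> 0 < eps -> 0 <= C ->
  exists J, forall Y : set 'rV[R]_d, locally_finite Y ->
    (forall a, ncube Y a 1 <= C) ->
    (forall h q j, (q0 h <= q)%N -> (2 ^ (d * q) <= j < 2 ^ (d * q).+1)%N ->
      forall p0 a : 'rV[R]_d,
      exists p : 'rV[R]_d, ncube Y p (2 ^+ (j + h)) = ncube Y p0 (2 ^+ (j + h)) /\
        forall i, a ord0 i <= p ord0 i /\
          p ord0 i + 2 ^+ (j + h) <= a ord0 i + 2 ^+ (j + h + (q + A))) ->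
    forall a b, ncube Y a (2 ^+ J) <= ncube Y b (2 ^+ J) + eps * 2 ^+ (J * d).
Proof.
move=> d2 e0 C0.
(* In the copied cube of side [2 ^ (j + h)], the grid of mesh [2 ^ j] misses at most the share
   [d / 2 ^ h]; [h] makes this cost at most [eps / 2] in density. *)
have [h hP] : exists h, 2 * d%:R * C / eps <= 2 ^+ h.
  exists (Num.truncn (2 * d%:R * C / eps)).+1.
  have x0 : 0 <= 2 * d%:R * C / eps by rewrite divr_ge0 ?mulr_ge0// ltW.
  have /andP[_ /ltW/le_trans] := truncn_itv x0; apply.
  by rewrite -natrX ler_nat ltnW// ltn_expl.
(* Half of the gap [eps] survives that loss; divided by [2 ^ (d (q + A))], the volume ratio of the
   two cubes, it is [c / 2 ^ (d q)]. *)
pose c : R := eps / 2 / 2 ^+ (d * A).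
have c0 : 0 < c by rewrite !divr_gt0// exprn_gt0.
have [J JP] := slow_decrement_bounded C (h + A) (q0 h) c0 d2.
exists J => Y Yfin YC Ycopy a b; rewrite leNgt; apply/negP => ab.
have p20 n : (0 : R) < 2 ^+ n by rewrite exprn_gt0.
have powE i j : (2 : R) ^+ (i + j) = (2 ^ i)%:R * 2 ^+ j by rewrite exprD natrX.
pose D j := [set ncube Y x (2 ^+ j) / 2 ^+ (j * d) | x in setT].
pose u j := sup (D j).
have Dle j x : ncube Y x (2 ^+ j) <= C * 2 ^+ (j * d).
  have := ncube_mul_le x (2 ^ j) Yfin (ltr01 : (0 : R) < 1) YC.
  by rewrite mulr1 natrX -exprM [leRHS]mulrC.
have Dsup j : has_sup (D j).
  split; first by exists (ncube Y 0 (2 ^+ j) / 2 ^+ (j * d)), 0.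
  by exists C => _ [x _ <-]; rewrite ler_pdivrMr.
have u_ub j x : ncube Y x (2 ^+ j) <= u j * 2 ^+ (j * d).
  rewrite -ler_pdivrMr//; apply: ub_le_sup; first by case: (Dsup j).
  by exists x.
have u_le j B : (forall x, ncube Y x (2 ^+ j) <= B * 2 ^+ (j * d)) -> u j <= B.
  move=> H; apply: ge_sup; first by case: (Dsup j).
  by move=> _ [x _ <-]; rewrite ler_pdivrMr.
have u_ge0 j : 0 <= u j.
  have := le_trans (ncube_ge0 Y 0 _) (u_ub j 0).
  by rewrite pmulr_lge0.
have u_leC j : u j <= C by exact: u_le.
have u_dec : {homo u : i j / (i <= j)%N >-> j <= i}.
  move=> i j ij; apply: u_le => x.
  have := ncube_mul_le x (2 ^ (j - i)) Yfin (p20 i) (u_ub i).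
  rewrite -powE subnK// => /le_trans; apply.
  by rewrite mulrCA natrX -exprM -exprD -mulnDl subnK.
(* The density of the sparse cube at [b]. Pigeonhole carries it down to every smaller scale, and the
   monotonicity of [u] does the same for the excess found at [a]. *)
pose al := ncube Y b (2 ^+ J) / 2 ^+ (J * d).
have low j : (j <= J)%N -> exists b', ncube Y b' (2 ^+ j) <= al * 2 ^+ (j * d).
  move=> jJ.
  have n0 : (0 < 2 ^ (J - j))%N by rewrite expn_gt0.
  have [b'] := exists_sparse_tile b Yfin (p20 j) n0.
  rewrite -powE subnK// => H; exists b'.
  have jE : (2 : R) ^+ (J * d) = (2 ^ (J - j))%:R ^+ d * 2 ^+ (j * d).
    by rewrite natrX -exprM -exprD -mulnDl subnK.
  rewrite /al mulrAC ler_pdivlMr// jE mulrCA mulrA.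
  by rewrite ler_wpM2r// ltW.
have high j : (j <= J)%N -> al + eps < u j.
  move=> jJ; apply: lt_le_trans (u_dec _ _ jJ).
  have := lt_le_trans ab (u_ub J a).
  by rewrite -ltr_pdivrMr// mulrDl mulfK ?gt_eqF.
apply: (JP u) => // [j _|q j q0q jP jJ]; first by rewrite u_ge0 u_leC.
have jJ' : (j + h <= J)%N by apply: leq_trans jJ; lia.
have [p0 p0P] := low _ jJ'.
apply: u_le => x.
have [p [pE pP]] := Ycopy _ _ _ q0q jP p0 x.
have U0 : 0 <= u j * 2 ^+ (j * d) by rewrite mulr_ge0// ltW.
have k0 : (0 < 2 ^ h)%N by rewrite expn_gt0.
have := @ncube_with_subcube_le _ _ Y x p (2 ^ (h + (q + A))) (2 ^ h) (2 ^+ j)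
  _ Yfin (p20 j) U0 k0 (u_ub j).
rewrite -!powE (addnC h j) (_ : (h + (q + A) + j = j + h + (q + A))%N); last by lia.
rewrite (_ : (j + (q + (h + A)) = j + h + (q + A))%N); last by lia.
move=> /(_ pP); rewrite pE => /le_trans; apply.
apply: le_trans (lerD p0P (lexx _)) _.
pose K : R := 2 ^+ (h * d).
have K0 : 0 < K by exact: p20.
have hE : (2 : R) ^+ ((j + h) * d) = K * 2 ^+ (j * d).
  by rewrite /K -exprD; congr (_ ^+ _); lia.
pose N : R := 2 ^+ ((q + A) * d).
have nE : (2 : R) ^+ ((j + h + (q + A)) * d) = N * K * 2 ^+ (j * d).
  by rewrite /K /N -!exprD; congr (_ ^+ _); lia.
have nE' : ((2 ^ (h + (q + A)))%:R : R) ^+ d = N * K.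
  by rewrite natrX -exprM /K /N -!exprD; congr (_ ^+ _); lia.
have cE : c / 2 ^+ (d * q) * N = eps / 2.
  rewrite /c /N mulnDl exprD [(q * d)%N]mulnC [(A * d)%N]mulnC.
  by field; rewrite !gt_eqF// ?p20.
have kle : K * (1 - d%:R / 2 ^+ h) <= (2 ^ h).-1%:R ^+ d.
  have x01 : 0 <= ((2 : R) ^+ h)^-1 <= 1.
    by rewrite invr_ge0 ltW//= invf_le1// exprn_ege1// ler1n.
  have := bernoulli_le d x01; rewrite -(ler_pM2l K0) => /le_trans; apply.
  rewrite /K exprM -exprMn mulrBr mulr1 divff ?gt_eqF//.
  by rewrite -natrX -subn1 natrB.
have dle : d%:R / 2 ^+ h * u j <= eps / 2.
  rewrite mulrAC ler_pdivrMr//; apply: le_trans (ler_wpM2l (ler0n _ _) (u_leC j)) _.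
  by move: hP; rewrite ler_pdivrMr//; lra.
(* Divided by [2 ^ (j d)], the claim is [K al + (N K - (2 ^ h - 1) ^ d) u_j <= (u_j - c / 2 ^ (d q))
   N K]. *)
rewrite hE nE nE' !mulrA -mulrDl; apply: ler_wpM2r; first exact: ltW.
have step1 : K * (1 - d%:R / 2 ^+ h) * u j <= (2 ^ h).-1%:R ^+ d * u j.
  by rewrite ler_wpM2r.
have step2 : K * (al + eps / 2) <= K * (u j - d%:R / 2 ^+ h * u j).
  rewrite ler_wpM2l ?(ltW K0)//; have := high j; rewrite (leq_trans _ jJ') ?leq_addr//.
  by move=> /(_ isT); lra.
have step3 : c / 2 ^+ (d * q) * N * K = eps / 2 * K by rewrite cE.
rewrite !mulrBl; move: step1 step2 step3; rewrite mulrBr mulrDr mulr1.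
set z := (2 ^ h).-1%:R ^+ d; set y := d%:R / 2 ^+ h; set w := c / 2 ^+ (d * q).
nra.
Qed.

(** * Linear images of repetitive Delone sets *)

(** For [s = 2 ^ (j + h)] the logarithm of a constant multiple of [s] is at most [2 ^ (d (q + 1))],
    so its [d]-th root is at most [2 ^ (q + 1)]; the remaining constants are absorbed in [2 ^ A].
    Only the threshold [q0] depends on [h]. *)
Lemma dyadic_repetitivity_bound (R : realType) (d : nat) (Rep : R -> R) (B : R) :
  (2 <= d)%N ->
  (forall r s, 0 < r -> r <= s -> Rep r <= Rep s) ->
  (exists2 C : R, 0 < C &
    \forall r \near +oo, Rep r <= C * (r * ln r `^ (d%:R^-1))) ->
  0 < B ->
  exists (A : nat) (q0 : nat -> nat), forall h q j, (q0 h <= q)%N ->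
    (2 ^ (d * q) <= j < 2 ^ (d * q).+1)%N ->
    forall r, 0 < r -> r <= B * 2 ^+ (j + h) ->
      B * (2 ^+ (j + h) + Rep r) <= 2 ^+ (j + h + (q + A)).
Proof.
move=> d2 Rep_le [C C0 [M [Mreal HM]]] B0.
have ex2 (x : R) : exists n, x <= 2 ^+ n.
  exists (Num.truncn x).+1; apply: (@le_trans _ _ (Num.truncn x).+1%:R).
    by apply: ltW; rewrite truncnS_gt.
  by rewrite -natrX ler_nat ltnW// ltn_expl.
have [k Bk] := ex2 B.
have [A hA] := ex2 (2 * 2 ^+ k * (1 + C * 2 ^+ k)).
(* [q >= h + k] lets [j] dominate the additive constants in the logarithm, and [q > M] puts
   [2 ^ k s] beyond the threshold of the asymptotic bound. *)
exists A, (fun h => h + k + (Num.truncn M).+1)%N => h q j /= q0q /andP[j1 j2] r r0 rs.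
have p20 n : (0 : R) < 2 ^+ n by rewrite exprn_gt0.
set s : R := 2 ^+ (j + h); have s0 : 0 < s by exact: p20.
have qlt : (q < 2 ^ (d * q))%N.
  by apply: (leq_trans (ltn_expl q (isT : 1 < 2)%N)); rewrite leq_exp2l// leq_pmull//; lia.
have Mlt : M < 2 ^+ k * s.
  apply: (lt_le_trans (truncnS_gt _)).
  rewrite /s -exprD -natrX ler_nat.
  apply: (@leq_trans j).
    by rewrite (leq_trans _ (leq_trans (ltnW qlt) j1))// (leq_trans _ q0q)// leq_addl.
  by apply: (leq_trans (ltnW (ltn_expl j (isT : 1 < 2)%N))); rewrite leq_exp2l//; lia.
have lnle : ln (2 ^+ k * s) `^ d%:R^-1 <= 2 ^+ q.+1.
  have -> : (2 : R) ^+ q.+1 = (2 ^+ (d * q.+1)) `^ d%:R^-1.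
    rewrite mulnC exprM -(powR_mulrn d) ?exprn_ge0// -powRrM.
    by rewrite divff ?powRr1 ?exprn_ge0// pnatr_eq0; lia.
  rewrite ge0_ler_powR ?invr_ge0 ?nnegrE//.
    apply: ln_ge0; rewrite /s -exprD exprn_ege1// ler1n//.
  rewrite /s -exprD lnXn//.
  apply: (@le_trans _ _ (k + (j + h))%:R).
    rewrite -[leLHS]mulr_natr -[leRHS]mul1r ler_wpM2r//.
    by rewrite -[2]/(1 + 1) le_ln1Dx.
  rewrite -natrX ler_nat.
  have : (2 ^ (d * q).+2 <= 2 ^ (d * q.+1))%N by rewrite leq_exp2l//; lia.
  by rewrite !expnS in j2 *; move: (2 ^ (d * q))%N (2 ^ (d * q.+1))%N j2 qlt q0q; lia.
have Rle : Rep r <= C * (2 ^+ k * s * 2 ^+ q.+1).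
  apply: (@le_trans _ _ (Rep (2 ^+ k * s))).
    apply: Rep_le => //; apply: (le_trans rs).
    by rewrite -/s ler_wpM2r// ltW.
  apply: (le_trans (HM _ Mlt)); rewrite ler_wpM2l ?(ltW C0)// ler_wpM2l//.
  by rewrite mulr_ge0 ?ltW.
have q1 : (1 : R) <= 2 ^+ q.+1 by rewrite exprn_ege1// ler1n.
apply: (@le_trans _ _ (2 ^+ k * (s * 2 ^+ q.+1 + C * (2 ^+ k * s * 2 ^+ q.+1)))).
  have S0 : 0 <= s * 2 ^+ q.+1 + C * (2 ^+ k * s * 2 ^+ q.+1).
    by rewrite addr_ge0 ?mulr_ge0 ?ltW ?mulr_gt0.
  apply: (@le_trans _ _ (B * (s * 2 ^+ q.+1 + C * (2 ^+ k * s * 2 ^+ q.+1)))).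
    by rewrite ler_wpM2l ?(ltW B0)// lerD// ler_peMr// ltW.
  by rewrite ler_wpM2r.
rewrite exprD -/s exprD.
have H : s * 2 ^+ q * (2 * 2 ^+ k * (1 + C * 2 ^+ k)) <= s * 2 ^+ q * 2 ^+ A.
  by rewrite ler_wpM2l// mulr_ge0// ltW.
rewrite [leRHS]mulrA (le_trans _ H)//.
by rewrite exprS le_eqVlt; apply/orP; left; apply/eqP; ring.
Qed.

Section linear_image.
Variables (R : realType) (d : nat).
Implicit Types (x y a p : 'rV[R]_d) (T : 'M[R]_d).

Lemma coord_le_norm x i : `|x ord0 i| <= `|x|.
Proof.
by rewrite -[leRHS]/(mx_norm x) mx_normrE; apply/bigmax_geP; right; exists (ord0, i).
Qed.

Lemma norm_le_coord x (B : R) : 0 <= B -> (forall i, `|x ord0 i| <= B) -> `|x| <= B.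
Proof.
move=> B0 xB; rewrite -[leLHS]/(mx_norm x) mx_normrE; apply/bigmax_leP; split => //.
by move=> [i j] _ /=; rewrite ord1.
Qed.

Lemma norm_le_enorm x : `|x| <= enorm x.
Proof.
apply: norm_le_coord; first exact: sqrtr_ge0.
move=> i; rewrite -sqrtr_sqr ler_sqrt; last first.
  by rewrite sumr_ge0// => j _; exact: sqr_ge0.
by rewrite (bigD1 i)//= lerDl sumr_ge0// => j _; exact: sqr_ge0.
Qed.

Lemma enorm_le_norm x : enorm x <= d%:R * `|x|.
Proof.
have x0 : 0 <= d%:R * `|x| by rewrite mulr_ge0.
rewrite -[leRHS]ger0_norm// -sqrtr_sqr ler_sqrt ?sqr_ge0//.
apply: (@le_trans _ _ (\sum_(i < d) `|x| ^+ 2)).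
  apply: ler_sum => i _; rewrite -[leLHS]real_normK ?num_real//.
  by rewrite lerXn2r ?nnegrE// coord_le_norm.
rewrite sumr_const card_ord -[leLHS]mulr_natl exprMn ler_wpM2r ?sqr_ge0//.
by rewrite -natrX ler_nat -mulnn; case: (d) => // n; rewrite leq_pmulr.
Qed.

Lemma norm_mulmx_le x T : (forall i j, `|T i j| <= d%:R) ->
  `|x *m T| <= d%:R ^+ 2 * `|x|.
Proof.
move=> Td; apply: norm_le_coord => [|i]; first by rewrite mulr_ge0// exprn_ge0.
rewrite mxE (le_trans (ler_norm_sum _ _ _))//.
apply: (@le_trans _ _ (\sum_(j < d) d%:R * `|x|)).
  by apply: ler_sum => j _; rewrite normrM mulrC ler_pM// coord_le_norm.
by rewrite sumr_const card_ord -[leLHS]mulr_natl mulrA expr2.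
Qed.

Lemma hcube_norm a s y : 0 <= s -> hcube a s y -> `|y - a| <= s.
Proof.
move=> s0 ys; apply: norm_le_coord => // i; rewrite !mxE.
have /andP[h1 h2] := ys i; rewrite ger0_norm ?subr_ge0// lerBlDl.
exact: ltW.
Qed.

Lemma finite_subset1 (U : choiceType) (Z : set U) : is_subset1 Z ->
  finite_set Z /\ (npts Z <= 1)%N.
Proof.
move=> Z1; have [[z Zz]|no] := pselect (exists z, Z z); last first.
  have -> : Z = set0 by rewrite -subset0 => z Zz; apply: no; exists z.
  by split; [exact: finite_set0|rewrite /npts fset_set0 cardfs0].
have -> : Z = [set z] by apply/seteqP; split => [y Zy|_ -> //]; exact: Z1.
by split; [exact: finite_set1|rewrite /npts fset_set1 cardfs1].
Qed.

(** Entry bounds depending on [d] alone keep every constant below independent of the matrices, hence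
    of the index of the encoding cubes. *)
Definition bounded_inverse_pair T T' :=
  [/\ T *m T' = 1%:M, T' *m T = 1%:M, forall i j, `|T i j| <= d%:R &
      forall i j, `|T' i j| <= d%:R].

(** [T] maps a cube of side [1 / w] into a ball of radius [r]. The factor [d ^ 3] is [d ^ 2] from
    [norm_mulmx_le] times [d] from passing to the Euclidean norm. *)
Lemma preimage_cube_subset1 (X : set 'rV[R]_d) : uniformly_discrete X ->
  exists2 w : nat, (0 < w)%N & forall T T', bounded_inverse_pair T T' ->
    forall a, is_subset1 ([set x | X (x *m T)] `&` hcube a w%:R^-1).
Proof.
move=> [r r0 Xr].
exists (Num.truncn (d%:R ^+ 3 / r)).+1 => // T T' [TT' T'T Td T'd] a x y [Xx xa] [Xy ya].
set w := (Num.truncn _).+1 in xa ya.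
have w0 : (0 : R) < w%:R by rewrite ltr0n.
have wr : d%:R ^+ 3 / w%:R < r.
  rewrite ltr_pdivrMr// mulrC -ltr_pdivrMr//; exact: truncnS_gt.
have H z : hcube a w%:R^-1 z -> eball (a *m T) r (z *m T).
  move=> za; rewrite /eball/= -mulmxBl; apply: le_lt_trans wr.
  apply: (le_trans (enorm_le_norm _)).
  rewrite exprS -mulrA ler_wpM2l//.
  apply: (le_trans (norm_mulmx_le (z - a) Td)); rewrite ler_wpM2l ?exprn_ge0//.
  by apply: hcube_norm => //; rewrite invr_ge0 ltW.
have xyT : x *m T = y *m T.
  by apply: (Xr (a *m T)); split => //; exact: H.
by rewrite -(mulmx1 x) -TT' mulmxA xyT -mulmxA TT' mulmx1.
Qed.

Lemma preimage_cube_finite (X : set 'rV[R]_d) : uniformly_discrete X ->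
  exists2 C : R, 0 <= C & forall T T', bounded_inverse_pair T T' ->
    locally_finite [set x | X (x *m T)] /\
    forall a, ncube [set x | X (x *m T)] a 1 <= C.
Proof.
move=> /preimage_cube_subset1[w w0 wX].
exists (w%:R ^+ d); first by rewrite exprn_ge0.
move=> T T' TT'; set Y := [set x | _].
have fin1 a := finite_subset1 (wX _ _ TT' a).
have w0' : (0 : R) < w%:R by rewrite ltr0n.
have wV0 : (0 : R) < w%:R^-1 by rewrite invr_gt0.
have Yfin : locally_finite Y.
  move=> a s; pose n := (Num.truncn (s / w%:R^-1)).+1.
  have sn : s <= n%:R * w%:R^-1.
    by rewrite -ler_pdivrMr// ltW// truncnS_gt.
  apply: (@sub_finite_set _ _ (\bigcup_(k in [set: {dffun forall i : 'I_d, 'I_n}])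
     (Y `&` hcube (tile_corner a w%:R^-1 k) w%:R^-1))).
    move=> x [Yx xa].
    have /(hbox_tile wV0)[k kx] : hbox a (fun=> n) w%:R^-1 x.
      move=> i; have /andP[-> h] := xa i.
      by rewrite (lt_le_trans h)// lerD2l.
    by exists k.
  apply: bigcup_finite => // k _.
  by have [] := fin1 (tile_corner a w%:R^-1 k).
split => // a.
have := @ncube_mul_le _ _ Y a w w%:R^-1 1 Yfin wV0.
rewrite mulfV ?gt_eqF// mulr1; apply => b.
by rewrite lern1; have [] := fin1 b.
Qed.

(** [T] maps the cube at [p0] into a patch about a point [x] of [X]. Repetitivity copies this patch
    near the image of the centre of the cube at [a], and [T'] pulls the translation by [x' - x] back
    to one that carries the points of [Y]. *)
Lemma preimage_patch_copy (X : set 'rV[R]_d) (Rep : R -> R) :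
  (2 <= d)%N -> uniformly_discrete X -> relatively_dense X ->
  repetitivity_function X Rep ->
  (exists2 C : R, 0 < C &
    \forall r \near +oo, Rep r <= C * (r * ln r `^ (d%:R^-1))) ->
  exists (A : nat) (q0 : nat -> nat), forall T T', bounded_inverse_pair T T' ->
    forall h q j, (q0 h <= q)%N -> (2 ^ (d * q) <= j < 2 ^ (d * q).+1)%N ->
    let Y := [set x | X (x *m T)] in
    forall p0 a, exists p, ncube Y p (2 ^+ (j + h)) = ncube Y p0 (2 ^+ (j + h)) /\
      forall i, a ord0 i <= p ord0 i /\
        p ord0 i + 2 ^+ (j + h) <= a ord0 i + 2 ^+ (j + h + (q + A)).
Proof.
move=> d2 /preimage_cube_finite[C _ HC] [R0 R00 XR0] [Rep0 Rep_le Rep_X] RepO.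
pose D : R := d%:R; have D1 : 1 <= D by rewrite ler1n; lia.
have D0 : 0 <= D := le_trans ler01 D1.
(* [E] is such that the patch radius [r] below is at most [E s]; [B] is such that
   [B (s + Rep r) <= L] leaves room for the copy in the cube of side [L]. *)
pose E : R := D ^+ 3 + D * R0 + 1.
pose B : R := 2 * D ^+ 2 * (R0 + E) + 2.
have E0 : 0 <= E by rewrite !addr_ge0 ?exprn_ge0 ?mulr_ge0// ltW.
have DD : 1 <= D ^+ 2 by rewrite exprn_ege1.
have RE : 0 <= R0 + E by rewrite addr_ge0// ltW.
have BE : E <= B.
  have : R0 + E <= D ^+ 2 * (R0 + E) by rewrite ler_peMl.
  rewrite /B; lra.
have B0 : 0 < B by rewrite /B ltr_wpDl// mulr_ge0// mulr_ge0// exprn_ge0.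
have BD : 2 * D ^+ 2 <= B.
  rewrite /B -subr_ge0; have : 2 * D ^+ 2 * 1 <= 2 * D ^+ 2 * (R0 + E).
    rewrite ler_wpM2l ?mulr_ge0 ?exprn_ge0// /E.
    have : 0 <= D ^+ 3 by rewrite exprn_ge0.
    have : 0 <= D * R0 by rewrite mulr_ge0// ltW.
    lra.
  lra.
have [A [q0 HA]] := dyadic_repetitivity_bound d2 Rep_le RepO B0.
exists A, q0 => T T' TT'p; have [TT' T'T Td T'd] := TT'p => h q j q0q jP Y p0 a.
pose s : R := 2 ^+ (j + h); pose L : R := 2 ^+ (j + h + (q + A)).
have s1 : 1 <= s by rewrite exprn_ege1// ler1n.
have s0 : 0 <= s by exact: le_trans s1.
have [x [Xx xp0]] := XR0 (p0 *m T).
(* The cube is within sup norm distance [s] of [p0], whose image is within [R0] of [x]; the leading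
   [D] passes to the Euclidean norm and the [1] makes the inequality strict. *)
pose r : R := D * (D ^+ 2 * s + R0) + 1.
have r0 : 0 < r by rewrite ltr_wpDl// mulr_ge0// addr_ge0 ?mulr_ge0 ?exprn_ge0// ltW.
have rE : r <= E * s.
  have : D * R0 <= D * R0 * s by rewrite ler_peMr// mulr_ge0// ltW.
  rewrite /r /E; lra.
have rB : r <= B * s by apply: (le_trans rE); rewrite ler_wpM2r.
have := HA h q j q0q jP r r0 rB; rewrite -/s -/L => HL.
pose c : 'rV[R]_d := a + const_mx (L / 2).
have [x' [[Xx' patchE] [z [[Xz zx'] zc]]]] := Rep_X r x (c *m T) r0 Xx.
have near_p0 y : hcube p0 s y -> enorm (y *m T - x) < r.
  move=> yp0; apply: (le_lt_trans (enorm_le_norm _)).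
  rewrite /r ltr_pwDr// ler_wpM2l//.
  rewrite (_ : _ - x = (y - p0) *m T - (x - p0 *m T)); last first.
    by rewrite mulmxBl opprB addrA subrK.
  apply: (le_trans (ler_normB _ _)); apply: lerD.
    apply: (le_trans (norm_mulmx_le _ Td)); rewrite ler_wpM2l ?exprn_ge0//.
    exact: hcube_norm.
  exact: le_trans (norm_le_enorm _) (ltW xp0).
pose v := (x' - x) *m T'.
have vT : v *m T = x' - x by rewrite -mulmxA T'T mulmx1.
exists (p0 + v); split.
  have -> : ncube Y p0 s = (npts ((fun y => y + v) @` (Y `&` hcube p0 s)))%:R.
    by rewrite npts_image//; [exact: addIr|have [Yfin _] := HC _ _ TT'p; exact: Yfin].
  congr ((npts _)%:R); apply/seteqP; split => [y [Yy yp]|_ [y [Yy yp] <-]].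
    have yp0 : hcube p0 s (y - v).
      by move=> i; have := yp i; rewrite !mxE; lra.
    exists (y - v); last by rewrite subrK.
    split => //; rewrite /Y/=.
    have : Defs.patch X x' r (y *m T).
      split => //; rewrite /eball/=; have := near_p0 _ yp0.
      by rewrite mulmxBl vT opprB addrA addrAC addrK.
    rewrite patchE => -[u [Xu _]] /eqP.
    rewrite eq_sym addrC -subr_eq -vT -mulmxBl => /eqP -> //.
  have : Defs.patch X x' r ((y + v) *m T).
    rewrite patchE; exists (y *m T); last by rewrite mulmxDl vT addrC.
    by split => //; exact: near_p0.
  case=> Xyv _; split => // i; have := yp i; rewrite !mxE; lra.
(* The path goes from [p0 *m T] to [x], from [x'] to the point [z] of the copy, and from [z] to the
   image of the centre; its parts cost [R0], [r] and [Rep r]. *)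
have pc : `|p0 + v - c| <= D ^+ 2 * (R0 + r + Rep r).
  have -> : p0 + v - c = (p0 *m T - x + (x' - z) + (z - c *m T)) *m T'.
    rewrite (_ : _ + (z - _) = (p0 + v - c) *m T); last first.
      rewrite mulmxBl (mulmxDl p0 v) vT; move: (p0 *m T) (c *m T) => f g.
      by apply/rowP => i; rewrite !mxE; ring.
    by rewrite -mulmxA TT' mulmx1.
  apply: (le_trans (norm_mulmx_le _ T'd)); rewrite ler_wpM2l ?exprn_ge0//.
  apply: (le_trans (ler_normD _ _)); apply: lerD; last first.
    exact: le_trans (norm_le_enorm _) (ltW zc).
  apply: (le_trans (ler_normD _ _)); apply: lerD.
    by rewrite distrC; exact: le_trans (norm_le_enorm _) (ltW xp0).
  by rewrite distrC; exact: le_trans (norm_le_enorm _) (ltW zx').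
(* A corner within [L / 2 - s] of the centre in every coordinate keeps a cube of side [s] inside the
   cube of side [L]. *)
have key : D ^+ 2 * (R0 + r + Rep r) + s <= L / 2.
  have Rr0 := Rep0 _ r0.
  have h1 : 2 * D ^+ 2 * Rep r <= B * Rep r by rewrite ler_wpM2r// ltW.
  have h2 : 2 * D ^+ 2 * (R0 + r) <= 2 * D ^+ 2 * ((R0 + E) * s).
    rewrite ler_wpM2l ?mulr_ge0 ?exprn_ge0// mulrDl lerD// ler_peMr// ltW//.
  have h3 : B * s = 2 * D ^+ 2 * ((R0 + E) * s) + 2 * s.
    by rewrite /B mulrDl mulrA.
  move: HL; rewrite mulrDr h3; lra.
move=> i; have := le_trans (coord_le_norm _ i) pc.
rewrite -/s -/L ler_norml !mxE => /andP[k1 k2]; split; lra.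
Qed.

End linear_image.

(** The scale [s] is chosen before [T], so it serves all cubes of the encoding. *)
Lemma uniform_density_gap (R : realType) (d : nat) (X : set 'rV[R]_d)
    (Rep : R -> R) :
  (2 <= d)%N -> delone X -> repetitivity_function X Rep ->
  (exists2 C : R, 0 < C &
    \forall r \near +oo, Rep r <= C * (r * ln r `^ (d%:R^-1))) ->
  forall eps : R, 0 < eps -> exists2 s : R, 0 < s &
    forall T T', bounded_inverse_pair T T' ->
      let Y := [set x | X (x *m T)] in
      forall a b, ncube Y a s <= ncube Y b s + eps * s ^+ d.
Proof.
move=> d2 [_ Xud Xrd] Xrep RepO eps eps0.
have [C C0 HC] := preimage_cube_finite Xud.
have [A [q0 Hcopy]] := preimage_patch_copy d2 Xud Xrd Xrep RepO.
have [J HJ] := density_gap A q0 d2 eps0 C0.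
exists (2 ^+ J); first by rewrite exprn_gt0.
move=> T T' TT' Y a b; rewrite -exprM.
have [Yfin YC] := HC _ _ TT'.
by apply: HJ => // h q j q0q jP; exact: (Hcopy _ _ TT').
Qed.

(** * Affine maps onto cubes *)

Lemma orthogonal_entry_le1 (R : realType) (d : nat) (U : 'M[R]_d) :
  U *m U^T = 1%:M -> forall i j, `|U i j| <= 1.
Proof.
move=> UU i j; rewrite -(@expr_le1 _ 2)// -normrX ger0_norm ?sqr_ge0//.
have <- : \sum_k U i k * U^T k i = 1.
  by have := congr1 (fun V : 'M[R]_d => V i i) UU; rewrite !mxE eqxx.
rewrite (bigD1 j)//= mxE -expr2 lerDl sumr_ge0// => k _.
by rewrite mxE -expr2 sqr_ge0.
Qed.

Lemma mulmx_entry_le (R : realType) (m n p : nat) (A : 'M[R]_(m, n))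
    (B : 'M[R]_(n, p)) :
  (forall i j, `|A i j| <= 1) -> (forall i j, `|B i j| <= 1) ->
  forall i j, `|(A *m B) i j| <= n%:R.
Proof.
move=> A1 B1 i j; rewrite mxE (le_trans (ler_norm_sum _ _ _))//.
rewrite -[n in leRHS]card_ord -sumr_const; apply: ler_sum => k _.
by rewrite normrM mulr_ile1.
Qed.

Lemma unit_cube_diff_le1 (R : realType) (d : nat) (x y : 'rV[R]_d) i j :
  unit_cube x -> unit_cube y -> `|(x - y) i j| <= 1.
Proof.
move=> xc yc; rewrite !mxE !ord1 ler_norml.
have := xc j; have := yc j.
by move=> /andP[? ?] /andP[? ?]; apply/andP; split; lra.
Qed.

Lemma unit_cube_delta (R : realType) (d : nat) (j : 'I_d) :
  unit_cube (delta_mx ord0 j : 'rV[R]_d).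
Proof. by move=> i; rewrite mxE eqxx/=; case: eqP; rewrite ?lexx ler01. Qed.

Lemma unit_cube0 (R : realType) (d : nat) : unit_cube (0 : 'rV[R]_d).
Proof. by move=> i; rewrite mxE lexx ler01. Qed.

(* The map [phi] need not be recognized as a similarity: a preimage of the vertices
   of [Q] provides a matrix [W] with [W *m T = U] and entries in [-1, 1], hence the
   inverse [U^T *m W] of [T]. *)
Lemma cube_affine_normal_form (R : realType) (d : nat) (r : R)
    (Q : set 'rV[R]_d) (phi : 'rV[R]_d -> 'rV[R]_d) :
  0 < r -> closed_cube r Q -> affine_map phi -> set_bij unit_cube Q phi ->
  exists T T' c, bounded_inverse_pair T T' /\
    forall x, phi x = (c + r *: x) *m T.
Proof.
move=> r0 [v [U [UU ->]]] [M [b phiE]] [phi_fun _ phi_surj].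
have r_neq0 : r != 0 by rewrite gt_eqF.
pose T := r^-1 *: M.
have MT : M = r *: T by rewrite scalerA mulfV// scale1r.
have U'U : U^T *m U = 1%:M by exact: mulmx1C.
have U1 := orthogonal_entry_le1 UU.
pose e (j : option 'I_d) : 'rV[R]_d := if j is Some k then delta_mx ord0 k else 0.
have ec j : unit_cube (e j).
  by case: j => [j|]; [exact: unit_cube_delta|exact: unit_cube0].
have /choice[f fP] (j : option 'I_d) : exists x, unit_cube x /\
    phi x = v + r *: (e j *m U).
  have [x xc xE] : (phi @` unit_cube) (v + r *: (e j *m U)).
    by apply: phi_surj; exists (e j).
  by exists x.
have phiB x y : phi x - phi y = r *: ((x - y) *m T).
  by rewrite !phiE opprD addrACA subrr addr0 -mulmxBl MT scalemxAr.
pose W : 'M[R]_d := \matrix_(j < d) (f (Some j) - f None).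
have WT : W *m T = U.
  apply/row_matrixP => j; rewrite row_mul rowK.
  apply: (scalerI r_neq0); rewrite -phiB.
  have [_ ->] := fP (Some j); have [_ ->] := fP None.
  by rewrite mul0mx scaler0 addr0 addrAC subrr add0r rowE.
have TT' : U^T *m W *m T = 1%:M by rewrite -mulmxA WT.
exists T, (U^T *m W), (b *m (U^T *m W)); split; last first.
  move=> x; rewrite mulmxDl -mulmxA TT' mulmx1 phiE MT addrC.
  by rewrite -scalemxAr -scalemxAl.
split; [exact: mulmx1C|by []| |].
  (* The vertices [delta_mx ord0 i] and [0] are sent to points of [Q] with coordinates [y] and [z]
     in the unit cube, so row [i] of [T] is [(y - z) *m U]. *)
  move=> i j.
  have [y yc yE] := phi_fun _ (unit_cube_delta R i).
  have [z zc zE] := phi_fun _ (@unit_cube0 R d).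
  have : (delta_mx ord0 i : 'rV_d) *m T = (y - z) *m U.
    apply: (scalerI r_neq0); rewrite -[X in X *m T]subr0 -phiB -yE -zE.
    by rewrite opprD addrACA subrr add0r mulmxBl scalerBr.
  rewrite -rowE => /(congr1 (fun x : 'rV_d => x ord0 j)).
  rewrite [LHS]mxE => ->; apply: mulmx_entry_le => // k l.
  exact: unit_cube_diff_le1.
apply: mulmx_entry_le => i j; first by rewrite mxE.
rewrite mxE; apply: unit_cube_diff_le1.
  by have [] := fP (Some i).
by have [] := fP None.
Qed.

(** * Encoded mass of a box *)

Section encoded_boxes.
Variables (R : realType) (d : nat) (X : set 'rV[R]_d) (T T' : 'M[R]_d)
  (c : 'rV[R]_d) (r : R) (phi : 'rV[R]_d -> 'rV[R]_d).
Hypotheses (TT' : bounded_inverse_pair T T') (r0 : 0 < r)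
  (phiE : forall x, phi x = (c + r *: x) *m T).
Let Y : set 'rV[R]_d := [set x | X (x *m T)].
Hypothesis Yfin : locally_finite Y.

Let mulT_inj : injective (fun x : 'rV[R]_d => x *m T).
Proof.
have [TT _ _ _] := TT' => x y /(congr1 (fun z => z *m T')).
by rewrite -!mulmxA TT !mulmx1.
Qed.

Lemma affine_inj : injective phi.
Proof.
move=> x y; rewrite !phiE => /mulT_inj /addrI; apply: scalerI.
by rewrite gt_eqF.
Qed.

Lemma image_cube_finite (A : set 'rV[R]_d) :
  finite_set (X `&` phi @` (A `&` unit_cube)).
Proof.
apply: (@sub_finite_set _ _ ((fun x => x *m T) @` (Y `&` hcube c (r + 1)))).
  move=> z [Xx [x [_ xc] xz]]; rewrite -{z}xz in Xx *; exists (c + r *: x); last by rewrite phiE.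
  split; first by rewrite /Y/= -phiE.
  move=> i; rewrite !mxE; have /andP[x0 x1] := xc i.
  rewrite lerDl mulr_ge0 ?(ltW r0)//= ltrD2l.
  by apply: (@le_lt_trans _ _ (r * 1)); [rewrite ler_wpM2l// ltW|rewrite mulr1 ltrDl].
exact: finite_image (Yfin _ _).
Qed.

(** In the coordinates of [Y] the box has sides [r (b_i - a_i)]. Covering it by cubes of side [s]
    overshoots each side by at most [s <= t r], which is the [t] in the product. *)
Lemma box_count_le (a b : 'rV[R]_d) (s t U : R) :
  (forall i, a ord0 i <= b ord0 i) -> 0 < s -> s <= t * r ->
  (forall p, ncube Y p s <= U) ->
  (npts (X `&` phi @` (box (a, b) `&` unit_cube)))%:R / r ^+ d <=
    \prod_(i < d) (b ord0 i - a ord0 i + t) * (U / s ^+ d).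
Proof.
move=> ab s0 st YU.
have U0 : 0 <= U := le_trans (ncube_ge0 Y 0 s) (YU 0).
pose m (i : 'I_d) := (Num.truncn (r * (b ord0 i - a ord0 i) / s)).+1.
have rab i : 0 <= r * (b ord0 i - a ord0 i).
  by rewrite mulr_ge0 ?subr_ge0// ltW.
have m1 i : r * (b ord0 i - a ord0 i) < (m i)%:R * s.
  by rewrite -ltr_pdivrMr//; exact: truncnS_gt.
have m2 i : (m i)%:R * s <= r * (b ord0 i - a ord0 i + t).
  have /andP[+ _] := truncn_div_bounds s0 (rab i).
  rewrite /m -natr1 [(_ + 1) * _]mulrDl mul1r [r * (_ + t)]mulrDr => h.
  by apply: lerD => //; rewrite mulrC.
have hfin : finite_set (Y `&` hbox (c + r *: a) m s).
  apply: (@sub_finite_set _ _ (\bigcup_(k in [set: {dffun forall i : 'I_d, 'I_(m i)}])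
     (Y `&` hcube (tile_corner (c + r *: a) s k) s))).
    by move=> x [Yx /(hbox_tile s0)[k kx]]; exists k.
  by apply: bigcup_finite => [|k _]; [exact: finite_finset|exact: Yfin].
have sub : X `&` phi @` (box (a, b) `&` unit_cube) `<=`
    (fun x => x *m T) @` (Y `&` hbox (c + r *: a) m s).
  move=> z [Xx [x [xab _] xz]]; rewrite -{z}xz in Xx *; exists (c + r *: x); last by rewrite phiE.
  split; first by rewrite /Y/= -phiE.
  move=> i; rewrite !mxE; have /andP[/= x0 x1] := xab i.
  rewrite lerD2l ler_wpM2l ?(ltW r0)//= -addrA ltrD2l.
  have := m1 i; have : r * x ord0 i <= r * b ord0 i by rewrite ler_wpM2l// ltW.
  by rewrite mulrBr; lra.
have cnt : (npts (X `&` phi @` (box (a, b) `&` unit_cube)))%:R <=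
    \prod_i (m i)%:R * U.
  apply: le_trans (npts_hbox_le (c + r *: a) m Yfin s0 YU).
  by rewrite ler_nat -(npts_image mulT_inj hfin) npts_le//; exact: finite_image.
rewrite ler_pdivrMr ?exprn_gt0//; apply: (le_trans cnt).
set p := \prod_(i < d) (_ + t); have -> : p * (U / s ^+ d) * r ^+ d = p * r ^+ d * U / s ^+ d.
  by ring.
rewrite ler_pdivlMr ?exprn_gt0// [leLHS]mulrAC ler_wpM2r// {}/p.
have prE (z : R) : z ^+ d = \prod_(i < d) z by rewrite prodr_const card_ord.
rewrite !prE -!big_split/=; apply: ler_prod => i _.
by rewrite mulr_ge0 ?ler0n ?(ltW s0)//= [leRHS]mulrC m2.
Qed.

(** The total count over the encoded cube forces one grid cube to be sparse, and the uniform gap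
    transfers its density, up to [eps], to all cubes of side [s]. Rounding the number of cells per
    edge down costs the factor [(1 - t) ^ d]. *)
Lemma box_density_le (a b : 'rV[R]_d) (s t eps : R) :
  (forall i, a ord0 i <= b ord0 i) -> 0 < s -> t < 1 -> s <= t * r ->
  (forall p q, ncube Y p s <= ncube Y q s + eps * s ^+ d) ->
  (npts (X `&` phi @` (box (a, b) `&` unit_cube)))%:R / r ^+ d <=
    \prod_(i < d) (b ord0 i - a ord0 i + t) *
    ((npts (X `&` phi @` unit_cube))%:R / r ^+ d / (1 - t) ^+ d + eps).
Proof.
move=> ab s0 t1 st Ygap; set P := (npts (X `&` phi @` unit_cube))%:R : R.
pose n := Num.truncn (r / s).
have /andP[n1 n2] := truncn_div_bounds s0 (ltW r0).
have n3 : (1 - t) * r < n%:R * s by rewrite /n; lra.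
have n0 : (0 < n)%N.
  rewrite -(ltr_nat R) -(ltr_pM2r s0) mul0r; apply: lt_trans n3.
  by rewrite mulr_gt0// subr_gt0.
have [q qP] := exists_sparse_tile c Yfin s0 n0.
have ncP : ncube Y c (n%:R * s) <= P.
  rewrite ler_nat -(npts_image mulT_inj (Yfin _ _)); apply: npts_le.
    by rewrite -[X in phi @` X]setTI; exact: image_cube_finite.
  move=> _ [y [Yy yc] <-]; split => //; exists (r^-1 *: (y - c)); last first.
    by rewrite phiE scalerA mulfV ?gt_eqF// scale1r addrC subrK.
  move=> i; rewrite !mxE; have /andP[y1 y2] := yc i.
  rewrite mulr_ge0 ?invr_ge0 ?subr_ge0 ?(ltW r0)//= mulrC ler_pdivrMr// mul1r.
  by rewrite /n in y2; lra.
have nR0 : (0 : R) < n%:R ^+ d by rewrite exprn_gt0// ltr0n.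
pose U := P / n%:R ^+ d + eps * s ^+ d.
have YU p : ncube Y p s <= U.
  apply: (le_trans (Ygap p q)); rewrite lerD2r ler_pdivlMr// mulrC.
  exact: le_trans ncP.
have t0 : 0 < t.
  by rewrite -(pmulr_lgt0 _ r0); exact: lt_le_trans st.
apply: (le_trans (box_count_le ab s0 st YU)).
apply: ler_wpM2l.
  by apply: prodr_ge0 => i _; rewrite addr_ge0 ?subr_ge0// ltW.
rewrite mulrDl mulfK ?expf_neq0 ?gt_eqF// lerD2r -!mulrA -!invfM.
have t1' : 0 < 1 - t by rewrite subr_gt0.
rewrite ler_wpM2l ?ler0n// lef_pV2 ?posrE ?mulr_gt0 ?exprn_gt0 ?ltr0n//.
have : ((1 - t) * r) ^+ d <= (n%:R * s) ^+ d.
  by apply: lerXn2r; rewrite ?nnegrE ?mulr_ge0// ltW.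
by rewrite !exprMn [leLHS]mulrC.
Qed.

End encoded_boxes.

(** * Boxes and measures *)

Section boxes_measurable.
Variables (R : realType) (d : nat).
Local Notation mu := (lebesgue_outer_measure R d).
Implicit Types (A : set 'rV[R]_d) (a b : 'rV[R]_d).

Lemma box_volume_ge0 (ab : 'rV[R]_d * 'rV[R]_d) : 0 <= box_volume ab.
Proof. by rewrite prodr_ge0// => i _; rewrite le_max lexx. Qed.

Definition set_coord (a : 'rV[R]_d) (i : 'I_d) (t : R) : 'rV[R]_d :=
  \row_j if j == i then t else a ord0 j.

Lemma max_sub_split (u v t : R) :
  Num.max 0 (Num.min v t - u) + Num.max 0 (v - Num.max u t) <= Num.max 0 (v - u).
Proof.
have mx (x : R) : (0 <= x /\ Num.max 0 x = x) \/ (x <= 0 /\ Num.max 0 x = 0).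
  by have [x0|x0] := leP 0 x; [left|right; rewrite (ltW x0)].
by case: (leP v t) => vt; case: (leP u t) => ut;
  case: (mx (v - u)) => -[h1 e1]; case: (mx (t - u)) => -[h2 e2];
  case: (mx (v - t)) => -[h3 e3]; lra.
Qed.

Lemma box_volume_split a b (i : 'I_d) (t : R) :
  box_volume (a, set_coord b i (Num.min (b ord0 i) t)) +
  box_volume (set_coord a i (Num.max (a ord0 i) t), b) <= box_volume (a, b).
Proof.
rewrite /box_volume/= !(bigD1 i (P := predT))//= !mxE eqxx.
set p := \prod_(j < d | j != i) Num.max 0 (b ord0 j - a ord0 j).
rewrite (eq_bigr (fun j => Num.max 0 (b ord0 j - a ord0 j))); last first.
  by move=> j /negbTE ji; rewrite mxE ji.
rewrite -/p [X in _ + _ * X](eq_bigr (fun j => Num.max 0 (b ord0 j - a ord0 j))); last first.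
  by move=> j /negbTE ji; rewrite mxE ji.
rewrite -/p -mulrDl ler_wpM2r//.
  by rewrite prodr_ge0// => j _; rewrite le_max lexx.
exact: max_sub_split.
Qed.

(** The hyperplane cuts every box of a cover of [Z] into two closed boxes of no larger total volume,
    one family covering [Z] inside [A], the other [Z] outside. Sandwiching [A] treats open and
    closed half-spaces at once. *)
Lemma half_space_measurable A (i : 'I_d) (t : R) :
  [set x : 'rV[R]_d | x ord0 i < t] `<=` A ->
  A `<=` [set x : 'rV[R]_d | x ord0 i <= t] ->
  mu.-caratheodory A.
Proof.
move=> ltA Ale; apply: le_caratheodory_measurable => Z.
apply: le_ereal_inf_tmp => _ [[I B] ZB <-] /=.
pose B1 k := ((B k).1, set_coord (B k).2 i (Num.min ((B k).2 ord0 i) t)).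
pose B2 k := (set_coord (B k).1 i (Num.max ((B k).1 ord0 i) t), (B k).2).
apply: (@le_trans _ _ (\esum_(k in I) (box_volume (B1 k))%:E +
                       \esum_(k in I) (box_volume (B2 k))%:E)%E).
  apply: leeD; apply: ereal_inf_lbound.
    exists (I, B1) => // x [/ZB[k /= Ik xk] Ax]; exists k => //= j.
    rewrite !mxE; case: eqP => [->|_]; last exact: xk.
    by have := xk i; rewrite le_min => /andP[-> ->]; exact: Ale.
  exists (I, B2) => // x [/ZB[k /= Ik xk] Ax]; exists k => //= j.
  rewrite !mxE; case: eqP => [->|_]; last exact: xk.
  have := xk i; rewrite ge_max => /andP[-> ->] /=; rewrite andbT.
  by rewrite leNgt; apply/negP => /ltA.
rewrite -esumD; try by move=> k _; rewrite lee_fin box_volume_ge0.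
apply: le_esum => k _; rewrite -EFinD lee_fin.
by rewrite [X in _ <= box_volume X]surjective_pairing; exact: box_volume_split.
Qed.

Lemma box_measurable (ab : 'rV[R]_d * 'rV[R]_d) :
  measurable (box ab : set (lebesgueType R d)).
Proof.
have -> : box ab = \bigcap_(i in [set: 'I_d])
    (~` [set x : 'rV[R]_d | x ord0 i < ab.1 ord0 i] `&`
     [set x : 'rV[R]_d | x ord0 i <= ab.2 ord0 i]).
  apply/seteqP; split => [x xab i _ /=|x xab i].
    by have /andP[h1 h2] := xab i; split => //; apply/negP; rewrite -leNgt.
  by have [/= /negP + ->] := xab i I; rewrite -leNgt => ->.
apply: fin_bigcap_measurable => [|i _]; first exact: finite_finset.
apply: measurableI; last first.
  by apply: (@half_space_measurable _ i (ab.2 ord0 i)) => // x; exact: ltW.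
apply: measurableC.
by apply: (@half_space_measurable _ i (ab.1 ord0 i)) => // x; exact: ltW.
Qed.

Lemma unit_cube_box : unit_cube = box (0, const_mx 1) :> set 'rV[R]_d.
Proof.
by apply/seteqP; split => x xc i; have := xc i; rewrite /= !mxE.
Qed.

Lemma unit_cube_measurable :
  measurable (unit_cube : set (lebesgueType R d)).
Proof. by rewrite unit_cube_box; exact: box_measurable. Qed.

Lemma lebesgue_box_le (ab : 'rV[R]_d * 'rV[R]_d) :
  (lebesgue_rV (box ab : set (lebesgueType R d)) <= (box_volume ab)%:E)%E.
Proof.
apply: ereal_inf_lbound; exists ([set 0%N], fun=> ab).
  by move=> x xab; exists 0%N.
by rewrite esum_set1// lee_fin box_volume_ge0.
Qed.

Lemma lebesgue_unit_cube_le1 :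
  (lebesgue_rV (unit_cube : set (lebesgueType R d)) <= 1)%E.
Proof.
rewrite unit_cube_box; apply: (le_trans (lebesgue_box_le _)).
rewrite lee_fin /box_volume big1// => i _.
by rewrite /= !mxE subr0 max_r.
Qed.

End boxes_measurable.

(** The integral of a nonnegative function is a supremum over the simple functions below it, and
    this family grows with the function. *)
Lemma le_integral_setfun d0 (T : measurableType d0) (R : realType)
    (mu : {measure set T -> \bar R}) (D : set T) (f g : T -> R) :
  (forall x, D x -> 0 <= f x <= g x) ->
  (\int[mu]_(x in D) (f x)%:E <= \int[mu]_(x in D) (g x)%:E)%E.
Proof.
move=> fg.
have f0 x : D x -> (0 <= (f x)%:E)%E by move=> /fg/andP[]; rewrite lee_fin.
have g0 x : D x -> (0 <= (g x)%:E)%E.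
  by move=> /fg/andP[h1 h2]; rewrite lee_fin (le_trans h1).
rewrite !ge0_integralE//; apply: ereal_sup_le => _ [h /= hf <-].
exists h => //= x; apply: (le_trans (hf x)).
rewrite /patch; case: ifPn => // /set_mem /fg/andP[_].
by rewrite lee_fin.
Qed.

(** * The encoding and density measures *)

Section encoding_is_measure.
Variables (R : realType) (d : nat).
Local Notation L := (lebesgueType R d).

Lemma finite_set_measurable (S : set L) : finite_set S -> measurable S.
Proof.
move=> Sfin; rewrite -[S]image_id -bigcup_imset1.
apply: fin_bigcup_measurable => // x _.
have -> : [set x] = box ((x, x) : 'rV[R]_d * 'rV[R]_d).
  apply/seteqP; split => [_ -> i /=|y yx]; first by rewrite lexx.
  by apply/rowP => i; apply/eqP; rewrite eq_le andbC; exact: yx.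
exact: box_measurable.
Qed.

Lemma counting_finite (T : choiceType) (S : set T) :
  finite_set S -> counting S = (npts S)%:R%:E :> \bar R.
Proof. by move=> Sfin; rewrite /counting asboolT. Qed.

Variables (X : set 'rV[R]_d) (phi : 'rV[R]_d -> 'rV[R]_d) (r : R).
Hypotheses (phi_inj : injective phi) (r0 : 0 < r)
  (Xfin : forall A, finite_set (X `&` phi @` (A `&` unit_cube))).

Lemma encoding_measureE (A : set L) :
  encoding_measure X r phi A =
  ((npts (X `&` phi @` (A `&` unit_cube)))%:R / r ^+ d)%:E.
Proof. by rewrite /encoding_measure counting_finite. Qed.

Let S : set L := [set x | unit_cube x /\ X (phi x)].

Let imageS (A : set L) : phi @` (A `&` S) = X `&` phi @` (A `&` unit_cube).
Proof.
apply/seteqP; split => [_ [x [Ax [xc Xx]] <-]|y [Xy [x [Ax xc] xy]]].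
  by split => //; exists x.
by exists x => //; split => //; split => //; rewrite xy.
Qed.

Let finiteS (A : set L) : finite_set (A `&` S).
Proof.
have inj : {in A `&` S &, injective phi} by move=> x y _ _; exact: phi_inj.
by rewrite -(eq_finite_set (inj_card_eq inj)) imageS.
Qed.

Let measurableS : measurable S.
Proof. by apply: finite_set_measurable; rewrite -[S]setTI. Qed.

Let scale_ge0 : 0 <= r ^- d.
Proof. by rewrite invr_ge0 exprn_ge0// ltW. Qed.

(** [encoding_measure] is a bare set function; for injective [phi] it agrees with this measure,
    which counts the finitely many points of the cube sent into [X] and divides by [r ^ d]. *)
Definition encoding_meas : {measure set L -> \bar R} :=
  mscale (NngNum scale_ge0) (mrestr counting measurableS).

Lemma encoding_measE : encoding_meas = encoding_measure X r phi :> (set L -> \bar R).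
Proof.
apply/funext => A; rewrite encoding_measureE.
have -> : encoding_meas A = ((r ^- d)%:E * counting (A `&` S))%E by [].
rewrite counting_finite//.
by rewrite -imageS npts_image// -EFinM mulrC.
Qed.

Lemma integral_encoding_le (A : set L) (f : 'rV[R]_d -> R) :
  measurable A -> (forall x, unit_cube x -> 0 <= f x <= \1_A x) ->
  (\int[encoding_measure X r phi]_(x in unit_cube) (f x)%:E <=
   ((npts (X `&` phi @` (A `&` unit_cube)))%:R / r ^+ d)%:E)%E.
Proof.
move=> mA fA; rewrite -encoding_measE.
apply: (le_trans (@le_integral_setfun _ L R encoding_meas unit_cube f \1_A fA)).
rewrite integral_indic//; last exact: unit_cube_measurable.
by rewrite encoding_measE encoding_measureE -setIA setIid.
Qed.

Lemma integral_encoding1 :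
  (\int[encoding_measure X r phi]_(x in unit_cube) 1%:E =
   ((npts (X `&` phi @` unit_cube))%:R / r ^+ d)%:E)%E.
Proof.
rewrite -encoding_measE integral_cst; last exact: unit_cube_measurable.
by rewrite mul1e encoding_measE encoding_measureE setIid.
Qed.

End encoding_is_measure.

Section density_is_measure.
Variables (R : realType) (d : nat) (rho : 'rV[R]_d -> R).
Local Notation L := (lebesgueType R d).
Hypotheses
  (mrho : measurable_fun (unit_cube : set L) (rho : L -> R))
  (rho0 : forall x, unit_cube x -> 0 < rho x).

Let mErho (A : set L) : measurable A ->
  measurable_fun (A `&` unit_cube) (fun x : L => (rho x)%:E : \bar R).
Proof.
move=> mA; apply/measurable_EFinP.
apply: measurable_funS mrho => //; exact: unit_cube_measurable.
Qed.

Let nu : set L -> \bar R := density_measure rho.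

Let nu0 : nu set0 = 0%E.
Proof. by rewrite /nu /density_measure set0I integral_set0. Qed.

Let nu_ge0 A : (0 <= nu A)%E.
Proof. by apply: integral_ge0 => x [_ /rho0/ltW]; rewrite lee_fin. Qed.

Let nu_semi_sigma_additive : semi_sigma_additive nu.
Proof.
move=> F mF tF mUF.
have -> : nu (\bigcup_n F n) = (\sum_(i <oo) nu (F i))%E.
  rewrite /nu /density_measure setI_bigcupl ge0_integral_bigcup//.
  - by move=> k; apply: measurableI => //; exact: unit_cube_measurable.
  - by rewrite -setI_bigcupl; exact: mErho.
  - by move=> x [k _ [_ /rho0/ltW]]; rewrite lee_fin.
  - exact: trivIset_setIr.
exact: is_cvg_nneseries.
Qed.

(** The two proofs are arguments so that the measure structure can be attached to the term
    [density_meas mrho rho0]. *)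
Definition density_meas
  of measurable_fun (unit_cube : set L) (rho : L -> R)
   & (forall x, unit_cube x -> 0 < rho x) : set L -> \bar R := nu.

HB.instance Definition _ := isMeasure.Build _ L R (density_meas mrho rho0)
  nu0 nu_ge0 nu_semi_sigma_additive.

End density_is_measure.

(** * Continuous test functions for boxes *)

Section bump.
Variables (R : realType) (d : nat) (a b : 'rV[R]_d) (t : R).

(* The summand of index [i] is twice the distance from [x_i] to [[a_i, b_i]]. *)
Definition box_bump (x : 'rV[R]_d) : R :=
  Num.max 0 (1 - (\sum_i (`|a ord0 i - x ord0 i| + `|x ord0 i - b ord0 i| -
                   (b ord0 i - a ord0 i))) / t).

Lemma box_bump_continuous : continuous box_bump.
Proof.
pose h i (u : R) : R := `|a ord0 i - u| + `|u - b ord0 i| - (b ord0 i - a ord0 i).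
pose S (x : 'rV[R]_d) : R := \sum_i h i (x ord0 i).
have hC i : continuous (h i).
  move=> u; apply: cvgB; last exact: cvg_cst.
  by apply: cvgD; apply: cvg_norm; apply: cvgB;
    [exact: cvg_cst|exact: cvg_id|exact: cvg_id|exact: cvg_cst].
have SC : continuous S.
  apply: continuous_big => [|i _]; first exact: add_continuous.
  move=> x; apply: (@continuous_comp _ _ _ (fun x : 'rV[R]_d => x ord0 i) (h i)).
    exact: coord_continuous.
  exact: hC.
have rC : continuous (fun s : R => Num.max 0 (1 - s / t) : R).
  under eq_fun do rewrite maxr_absE add0r sub0r normrN.
  have rC : continuous (fun s : R => 1 - s / t).
    move=> s; apply: cvgB; first exact: cvg_cst.
    by apply: cvgM; [exact: cvg_id|exact: cvg_cst].
  move=> s; apply: cvgM; last exact: cvg_cst.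
  by apply: cvgD; [exact: rC|apply: cvg_norm; exact: rC].
by move=> x; apply: (continuous_comp (SC x) (rC _)).
Qed.

Hypotheses (ab : forall i, a ord0 i <= b ord0 i) (t0 : 0 < t).

Let term_ge0 (x : 'rV[R]_d) i :
  0 <= `|a ord0 i - x ord0 i| + `|x ord0 i - b ord0 i| - (b ord0 i - a ord0 i).
Proof.
have := ler_norm (x ord0 i - a ord0 i); rewrite distrC.
have := ler_norm (b ord0 i - x ord0 i); rewrite (distrC (b ord0 i)).
lra.
Qed.

Lemma box_bump01 x : 0 <= box_bump x <= 1.
Proof.
rewrite /box_bump le_max lexx/= ge_max ler01/= lerBlDr lerDl divr_ge0 ?(ltW t0)//.
exact: sumr_ge0.
Qed.

Lemma box_bump_eq1 x : box (a, b) x -> box_bump x = 1.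
Proof.
move=> xab; rewrite /box_bump big1 ?mul0r ?subr0 ?max_r// => i _.
have /andP[/= h1 h2] := xab i.
by rewrite ler0_norm ?ler0_norm ?subr_le0//; ring.
Qed.

Lemma box_bump_eq0 x : ~ box (a - const_mx t, b + const_mx t) x -> box_bump x = 0.
Proof.
move=> /existsNP[i /negP xi]; rewrite /box_bump max_l// subr_le0 ler_pdivlMr// mul1r.
(* Outside the enlarged box, the summand of the violated coordinate [i] alone is at least [t]. *)
rewrite (bigD1 i)//=; apply: ler_wpDr; first exact: sumr_ge0.
have ha := ler_norm (x ord0 i - a ord0 i); rewrite distrC in ha.
have hb := ler_norm (b ord0 i - x ord0 i); rewrite distrC in hb.
have ha' := ler_norm (a ord0 i - x ord0 i).
have hb' := ler_norm (x ord0 i - b ord0 i).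
move: xi; rewrite !mxE negb_and -!ltNge => /orP[] h; have := ab i; lra.
Qed.

Lemma box_bump_ge_indic x : \1_(box (a, b)) x <= box_bump x.
Proof.
rewrite indicE; have [/set_mem/box_bump_eq1->//|_] := boolP (x \in _).
by have /andP[] := box_bump01 x.
Qed.

Lemma box_bump_le_indic x : box_bump x <= \1_(box (a - const_mx t, b + const_mx t)) x.
Proof.
rewrite indicE; have [_|/negP xab] := boolP (x \in _).
  by have /andP[] := box_bump01 x.
by rewrite box_bump_eq0// => /mem_set.
Qed.

End bump.

Lemma poly_ge0_at0 (R : realType) (p : {poly R}) :
  (forall t, 0 < t < 1 -> 0 <= p.[t]) -> 0 <= p.[0].
Proof.
move=> p0; rewrite leNgt; apply/negP => pneg.
have /(cvgr_lt p.[0]) /(_ 0 pneg) : p.[x] @[x --> (0 : R)] --> p.[0].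
  exact: continuous_horner.
move=> [e /= e0 He].
pose t := Num.min (e / 2) 2^-1.
have t01 : 0 < t < 1.
  by rewrite lt_min divr_gt0//= invr_gt0 ltr0n/= gt_min invf_lt1 ?ltr1n ?orbT.
have := p0 _ t01; rewrite leNgt => /negP; apply; apply: He => /=.
have /andP[tp _] := t01.
rewrite sub0r normrN gtr0_norm// (le_lt_trans (_ : t <= e / 2)) ?ge_min ?lexx//.
by rewrite ltr_pdivrMr// ltr_pMr// ltr1n.
Qed.

(** * Comparison with Lebesgue measure *)

(** By sigma-subadditivity every cover of [E] by boxes bounds [nu E] by [D] times its total volume;
    the infimum over the covers is the Lebesgue measure. *)
Lemma density_le_lebesgue (R : realType) (d : nat) (D : R)
    (nu : {measure set (lebesgueType R d) -> \bar R}) :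
  0 < D ->
  (forall ab, (nu (box ab) <= (D * box_volume ab)%:E)%E) ->
  forall E, measurable E -> (nu E <= D%:E * lebesgue_rV E)%E.
Proof.
move=> D0 nuD E mE.
rewrite -lee_pdivrMl//; apply: le_ereal_inf_tmp => _ [[I B] EB <-] /=.
pose F k : set (lebesgueType R d) := if k \in I then box (B k) else set0.
have mF k : measurable (F k).
  by rewrite /F; case: ifP => // _; exact: box_measurable.
have nuE : (nu E <= \sum_(k <oo) nu (F k))%E.
  apply: measure_sigma_subadditive => // x /EB[k /= Ik xk].
  by exists k => //; rewrite /F mem_set.
have D1 : (0 <= D^-1%:E)%E by rewrite lee_fin invr_ge0 ltW.
apply: (le_trans (lee_wpmul2l D1 nuE)).
rewrite -nneseriesZl// nneseries_esumT; last by move=> k; rewrite mule_ge0.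
rewrite [leRHS]esum_mkcond; apply: le_esum => k _.
rewrite /F; case: ifP => _; last by rewrite measure0 mule0.
by rewrite lee_pdivrMl.
Qed.

(** The bound [nu <= D L] on the complement gives [nu E >= D - D L (unit_cube \ E) >= D L E], as the
    cube has measure at most 1. Equality on all measurable subsets of the cube determines the
    density almost everywhere. *)
Lemma density_ae_constant (R : realType) (d : nat) (rho : 'rV[R]_d -> R) (D : R) :
  measurable_fun (unit_cube : set (lebesgueType R d)) (rho : lebesgueType R d -> R) ->
  (forall x, unit_cube x -> 0 < rho x) ->
  density_measure rho unit_cube = D%:E ->
  (forall ab, (density_measure rho (box ab) <= (D * box_volume ab)%:E)%E) ->
  {ae @lebesgue_rV R d, forall x, unit_cube x -> rho x = D}.
Proof.
move=> mrho rho0 nuD nu_box.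
pose L := lebesgueType R d.
pose nu : {measure set L -> \bar R} := density_meas mrho rho0.
have mC : measurable (unit_cube : set L) := @unit_cube_measurable R d.
have nuC : nu unit_cube = D%:E := nuD.
have D0 : 0 <= D by rewrite -lee_fin -nuC.
have lamfin (E : set L) : measurable E -> E `<=` unit_cube ->
    (lebesgue_rV E <= 1)%E.
  move=> mE EC; apply: le_trans (@lebesgue_unit_cube_le1 R d).
  by apply: le_measure => //; exact: mem_set.
have nu_le (E : set L) : measurable E -> E `<=` unit_cube ->
    (nu E <= D%:E * lebesgue_rV E)%E.
  (* For [D = 0] one cannot divide by [D], but then [nu] vanishes on the cube. *)
  move=> mE EC; have [D0'|D0'] := eqVneq D 0; last first.
    by apply: density_le_lebesgue => //; rewrite lt_def D0' D0.
  have nuC0 : nu unit_cube = 0%E by rewrite nuC D0'.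
  rewrite D0' mul0e -[leRHS]nuC0.
  by apply: le_measure => //; exact: mem_set.
have nu_eq (E : set L) : measurable E -> E `<=` unit_cube ->
    nu E = (D%:E * lebesgue_rV E)%E.
  move=> mE EC; apply/eqP; rewrite eq_le nu_le// andTb.
  have mCE : measurable (unit_cube `\` E : set L) by exact: measurableD.
  have CEC : unit_cube `\` E `<=` (unit_cube : set L) by exact: subDsetl.
  have addC (m : {measure set L -> \bar R}) :
      m unit_cube = (m E + m (unit_cube `\` E))%E.
    rewrite -measureU//; last by rewrite setDIK.
    by rewrite setDUK.
  have fin (E' : set L) : measurable E' -> E' `<=` unit_cube ->
      lebesgue_rV E' \is a fin_num.
    move=> mE' E'C; rewrite ge0_fin_numE//.
    by apply: (le_lt_trans (lamfin _ mE' E'C)); rewrite ltry.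
  have nfin (E' : set L) : measurable E' -> E' `<=` unit_cube -> nu E' \is a fin_num.
    move=> mE' E'C; rewrite ge0_fin_numE//.
    apply: (@le_lt_trans _ _ (nu unit_cube)); last by rewrite nuC ltry.
    by apply: le_measure => //; exact: mem_set.
  have [x1 x1E] : exists x, nu E = x%:E by exists (fine (nu E)); rewrite fineK ?nfin.
  have [x2 x2E] : exists x, nu (unit_cube `\` E) = x%:E.
    by exists (fine (nu (unit_cube `\` E))); rewrite fineK ?nfin.
  have [y1 y1E] : exists y, lebesgue_rV E = y%:E.
    by exists (fine (lebesgue_rV E)); rewrite fineK ?fin.
  have [y2 y2E] : exists y, lebesgue_rV (unit_cube `\` E : set L) = y%:E.
    by exists (fine (lebesgue_rV (unit_cube `\` E : set L))); rewrite fineK ?fin.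
  have h1 := nu_le _ mCE CEC; rewrite x2E y2E -EFinM lee_fin in h1.
  have h2 := addC nu; rewrite x1E x2E nuC -EFinD in h2; case: h2 => h2.
  have h3 := lamfin _ mC (@subset_refl _ _).
  rewrite addC y1E y2E -EFinD lee_fin in h3.
  rewrite x1E y1E -EFinM lee_fin.
  have : D * (y1 + y2) <= D * 1 by rewrite ler_wpM2l.
  rewrite mulrDr; lra.
have intE (E : set L) : E `<=` unit_cube -> nu E = (\int[lebesgue_rV]_(x in E) (rho x)%:E)%E.
  by move=> EC; rewrite /nu /= /density_meas /density_measure setIidl.
have mErho : measurable_fun (unit_cube : set L) (fun x : L => (rho x)%:E).
  exact/measurable_EFinP.
have : ae_eq lebesgue_rV (unit_cube : set L) (fun x : L => (rho x)%:E) (cst D%:E).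
  apply: integral_ae_eq => //.
    apply/integrableP; split => //.
    have -> : (\int[lebesgue_rV]_(x in (unit_cube : set L)) `|(rho x)%:E| =
        \int[lebesgue_rV]_(x in (unit_cube : set L)) (rho x)%:E)%E.
      by apply: eq_integral => x /set_mem /rho0 /ltW; rewrite -lee_fin => /gee0_abs.
    by rewrite -intE// nuC ltry.
  by move=> E EC mE; rewrite -intE// integral_cst// nu_eq.
by apply: filterS => x xE /xE [].
Qed.

(** * Limit of the encoding measures *)

Lemma nonneg_test_bounded (R : realType) (d : nat) (f : 'rV[R]_d -> R) :
  (forall x, 0 <= f x <= 1) -> [bounded f x | x in unit_cube].
Proof.
move=> f01; exists 1; split; first exact: num_real.
move=> M M1 x _; have /andP[f0 f1] := f01 x.
by rewrite /= ger0_norm// (le_trans f1)// ltW.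
Qed.

Section encoded_density.
Variables (R : realType) (d : nat) (d_ge2 : (2 <= d)%N)
  (rho : 'rV[R]_d -> R)
  (mrho : measurable_fun (unit_cube : set (lebesgueType R d))
            (rho : lebesgueType R d -> R))
  (rho0 : forall x, unit_cube x -> 0 < rho x)
  (X : set 'rV[R]_d) (X_delone : delone X)
  (Rep : R -> R) (Rep_X : repetitivity_function X Rep)
  (Rep_bigO : exists2 C : R, 0 < C &
     \forall r \near +oo, Rep r <= C * (r * ln r `^ (d%:R^-1)))
  (r : nat -> R) (Q : nat -> set 'rV[R]_d) (phi : nat -> 'rV[R]_d -> 'rV[R]_d).
Hypotheses (r0 : forall n, 0 < r n) (r_oo : r n @[n --> \oo] --> +oo)
  (cubeQ : forall n, closed_cube (r n) (Q n))
  (phiQ : forall n, affine_map (phi n) /\ set_bij unit_cube (Q n) (phi n))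
  (mu_nu : weak_cvg (fun n => encoding_measure X (r n) (phi n))
                    (density_measure rho)).

Local Notation L := (lebesgueType R d).
Let nu : {measure set L -> \bar R} := density_meas mrho rho0.
Let P n : R := (npts (X `&` phi n @` unit_cube))%:R / r n ^+ d.

Let normal_form n : exists TTc : 'M[R]_d * 'M[R]_d * 'rV[R]_d,
  bounded_inverse_pair TTc.1.1 TTc.1.2 /\
  forall x, phi n x = (TTc.2 + r n *: x) *m TTc.1.1.
Proof.
have [phin bijn] := phiQ n.
have [T [T' [c [TT' phiE]]]] := cube_affine_normal_form (r0 n) (cubeQ n) phin bijn.
by exists (T, T', c).
Qed.

Let Yfin T T' : bounded_inverse_pair T T' -> locally_finite [set x | X (x *m T)].
Proof.
have [_ Xud _] := X_delone; have [C _ HC] := preimage_cube_finite Xud.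
by move=> /HC[].
Qed.

Let phi_inj n : injective (phi n).
Proof.
have [[[T T'] c] [TT' phiE]] := normal_form n.
exact: affine_inj TT' (r0 n) phiE.
Qed.

Let fin n A : finite_set (X `&` phi n @` (A `&` unit_cube)).
Proof.
have [[[T T'] c] [TT' phiE]] := normal_form n.
exact: image_cube_finite (r0 n) phiE (Yfin TT') A.
Qed.

Let r_large (z : R) : \forall n \near \oo, z <= r n.
Proof. by move/cvgryPge : r_oo => /(_ z). Qed.

Let mass_cvg : ((P n)%:E @[n --> \oo] --> nu unit_cube)%E.
Proof.
have := mu_nu (f := cst 1) _ _.
under eq_cvg do rewrite (integral_encoding1 (@phi_inj _) (r0 _) (@fin _)).
have -> : (\int[density_measure rho]_(x in unit_cube) ((cst 1 : _ -> R) x)%:E)%E = nu unit_cube.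
  rewrite -[LHS]/(\int[nu]_(x in unit_cube) (cst 1%:E) x)%E.
  by rewrite integral_cst ?mul1e//; exact: unit_cube_measurable.
apply; first by apply: continuous_subspaceT; exact: cst_continuous.
by apply: nonneg_test_bounded => x; rewrite ler01 lexx.
Qed.

Lemma density_cube_finite : exists2 D : R, 0 <= D & density_measure rho unit_cube = D%:E.
Proof.
have nu0 : (0 <= nu unit_cube)%E by [].
have [_ Xud _] := X_delone; have [C C0 HC] := preimage_cube_finite Xud.
suff : (nu unit_cube <= (2 ^+ d * C)%:E)%E.
  move=> le; have nufin : nu unit_cube \is a fin_num.
    by rewrite ge0_fin_numE// (le_lt_trans le)// ltry.
  by exists (fine (nu unit_cube)); [exact: fine_ge0|rewrite fineK].
apply: cvge_le mass_cvg; near=> n.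
rewrite lee_fin /P.
have [[[T T'] c] [TT' phiE]] := normal_form n.
have [Yf YC] := HC _ _ TT'.
have ab i : (0 : 'rV[R]_d) ord0 i <= (const_mx 1 : 'rV[R]_d) ord0 i by rewrite !mxE.
have r1 : 1 <= 1 * r n by rewrite mul1r; near: n; exact: r_large.
(* With [s = t = 1] the sides of the unit cube grow to 2, whence the bound [2 ^ d C]. *)
have := box_count_le TT' (r0 n) phiE Yf ab ltr01 r1 YC.
rewrite -unit_cube_box setIid expr1n divr1 => /le_trans; apply.
rewrite (eq_bigr (fun=> 2)) ?prodr_const ?card_ord// => i _.
by rewrite !mxE subr0.
Unshelve. all: by end_near. Qed.

(** A bump function lies between the indicators of the box and of its enlargement by [t]. Weak
    convergence lets [n] tend to infinity for fixed [t]; then [t] tends to 0. *)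
Lemma density_box_le (D : R) : 0 <= D -> density_measure rho unit_cube = D%:E ->
  forall ab, (density_measure rho (box ab) <= (D * box_volume ab)%:E)%E.
Proof.
move=> D0 nuD [a b].
have [ab|/existsNP[i /negP]] := pselect (forall i, a ord0 i <= b ord0 i); last first.
  rewrite -ltNge => ba; have -> : box (a, b) = set0.
    rewrite -subset0 => x /(_ i)/= /andP[h1 h2].
    by have := lt_le_trans ba (le_trans h1 h2); rewrite ltxx.
  rewrite -[density_measure rho set0]/(nu set0) measure0 lee_fin.
  by rewrite mulr_ge0// box_volume_ge0.
have nub_le : (nu (box (a, b)) <= nu unit_cube)%E.
  have -> : nu (box (a, b)) = nu (box (a, b) `&` unit_cube).
    by rewrite /nu/= /density_meas /density_measure -setIA setIid.
  have mC : measurable (unit_cube : set L) := @unit_cube_measurable R d.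
  apply: le_measure; [|exact: mem_set|exact: subIsetr].
  by apply: mem_set; apply: measurableI => //; exact: box_measurable.
have nubfin : nu (box (a, b)) \is a fin_num.
  by rewrite ge0_fin_numE// (le_lt_trans nub_le)// [nu _]nuD ltry.
pose v := fine (nu (box (a, b))).
have vE : nu (box (a, b)) = v%:E by rewrite fineK.
(* [3 * t] is the enlargement by [t] on both sides plus the rounding in [box_density_le]; [D + t]
   bounds the total mass for large [n]; the last [t] is the density gap. *)
pose g (t : R) := \prod_(i < d) (b ord0 i - a ord0 i + 3 * t) *
  ((D + t) / (1 - t) ^+ d + t).
have vg t : 0 < t < 1 -> v <= g t.
  move=> /andP[t0 t1].
  have [s s0 gap] := uniform_density_gap d_ge2 X_delone Rep_X Rep_bigO t0.
  have f_cvg := mu_nu (continuous_subspaceT (@box_bump_continuous _ _ a b t))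
    (nonneg_test_bounded (box_bump01 a b t0)).
  have le1 : (v%:E <= \int[nu]_(x in unit_cube) (box_bump a b t x)%:E)%E.
    have -> : v%:E = (\int[nu]_(x in unit_cube) (\1_(box (a, b)) x)%:E)%E.
      rewrite integral_indic; [|exact: unit_cube_measurable|exact: box_measurable].
      by rewrite -vE /nu/= /density_meas /density_measure -setIA setIid.
    apply: (@le_integral_setfun _ L R nu unit_cube \1_(box (a, b)) (box_bump a b t)) => x _.
    by rewrite box_bump_ge_indic// indicE ler0n.
  rewrite -lee_fin; apply: (le_trans le1); apply: cvge_le f_cvg.
  have PD : \forall n \near \oo, P n <= D + t.
    have Dt : D < D + t by rewrite ltrDl.
    have := mass_cvg; rewrite [nu _]nuD => /fine_cvgP[_ P_cvg].
    exact: cvgr_le _ P_cvg _ Dt.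
  near=> n.
  have [[[T T'] c] [TT' phiE]] := normal_form n.
  have st : s <= t * r n.
    by rewrite mulrC -ler_pdivrMr//; near: n; exact: r_large.
  pose a' := a - const_mx t; pose b' := b + const_mx t.
  have ab' i : a' ord0 i <= b' ord0 i by rewrite !mxE; have := ab i; lra.
  have := box_density_le TT' (r0 n) phiE (Yfin TT') ab' s0 t1 st (gap _ _ TT').
  have := @integral_encoding_le _ _ X (phi n) (r n) (@phi_inj n) (r0 n)
    (@fin n) (box (a', b')) (box_bump a b t) (box_measurable _) _.
  move=> /(_ _)/le_trans H1 H2; apply: H1.
    move=> x _; rewrite box_bump_le_indic// andbT.
    by have /andP[] := box_bump01 a b t0 x.
  rewrite lee_fin; apply: (le_trans H2); rewrite /g.
  rewrite (eq_bigr (fun i => b ord0 i - a ord0 i + 3 * t)); last first.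
    by move=> i _; rewrite !mxE; ring.
  apply: ler_wpM2l.
    by apply: prodr_ge0 => i _; rewrite addr_ge0 ?subr_ge0// mulr_ge0// ltW.
  rewrite lerD2r ler_wpM2r ?invr_ge0 ?exprn_ge0 ?subr_ge0 ?(ltW t1)//.
  by near: n.
(* [g t - v] multiplied by [(1 - t) ^ d], which makes it a polynomial in [t]; its value at 0 is [D]
   times the volume minus [v]. *)
pose p : {poly R} := \prod_(i < d) ((b ord0 i - a ord0 i)%:P + 3%:P * 'X) *
  (D%:P + 'X + 'X * (1 - 'X) ^+ d) - v%:P * (1 - 'X) ^+ d.
have pE t : p.[t] = \prod_(i < d) (b ord0 i - a ord0 i + 3 * t) *
    (D + t + t * (1 - t) ^+ d) - v * (1 - t) ^+ d.
  rewrite /p !hornerE horner_prod; congr (_ * _ - _).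
  by apply: eq_bigr => i _; rewrite !hornerE.
have := @poly_ge0_at0 _ p; rewrite !pE => /(_ _).
rewrite -[density_measure rho _]/(nu _) vE lee_fin.
rewrite subr0 expr1n mul0r !addr0 mulr1 subr_ge0.
have -> : \prod_(i < d) (b ord0 i - a ord0 i + 3 * 0) = box_volume (a, b).
  by apply: eq_bigr => i _; rewrite mulr0 addr0 max_r// subr_ge0.
rewrite mulrC; apply => t t01; rewrite pE.
have /andP[t0 t1] := t01.
have t1d : 0 < (1 - t) ^+ d by rewrite exprn_gt0// subr_gt0.
rewrite subr_ge0 -ler_pdivlMr//; apply: (le_trans (vg t t01)); rewrite /g.
rewrite -mulrA ler_wpM2l//.
  by apply: prodr_ge0 => i _; rewrite addr_ge0 ?subr_ge0// mulr_ge0// ltW.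
by rewrite [leRHS]mulrDl mulfK// gt_eqF.
Unshelve. all: by end_near. Qed.

End encoded_density.

Theorem theorem1p6 (R : realType) (d : nat) (d_ge2 : (2 <= d)%N)
    (rho : 'rV[R]_d -> R)
    (rho_measurable : measurable_fun (unit_cube : set (lebesgueType R d))
                        (rho : lebesgueType R d -> R))
    (rho_gt0 : forall x, unit_cube x -> 0 < rho x)
    (X : set 'rV[R]_d) (X_delone : delone X)
    (Rep : R -> R) (Rep_X : repetitivity_function X Rep)
    (Rep_bigO : exists2 C : R, 0 < C &
       \forall r \near +oo, Rep r <= C * (r * ln r `^ (d%:R^-1)))
    (X_rho : encodes X rho) :
  exists c : R, {ae @lebesgue_rV R d, forall x, unit_cube x -> rho x = c}.
Proof.
have [r [Q [phi [r0 r_oo cubeQ phiQ mu_nu]]]] := X_rho.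
have [D D0 nuD] := density_cube_finite rho_measurable rho_gt0 X_delone r0 r_oo
  cubeQ phiQ mu_nu.
exists D; apply: density_ae_constant => //.
exact: (density_box_le d_ge2 rho_measurable rho_gt0 X_delone Rep_X Rep_bigO r0
  r_oo cubeQ phiQ mu_nu).
Qed.
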